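(* Let $p$ be an odd prime and let $G$ be a group of order $p^5$ with $|Z(G)|=p^2$. Then $|\mathcal{M}(G)|\neq p^5$; that is, no such group satisfies $|\mathcal{M}(G)|=p^{\frac12\cdot 5\cdot 4-5}$.
   Context: $\mathcal{M}(G)$ denotes the Schur multiplier of $G$ and $Z(G)$ the center. *)

(* Defs.v *)
From HB Require Import structures.
From mathcomp Require Import all_boot all_order all_algebra all_fingroup all_solvable all_field.
Set Implicit Arguments. Unset Strict Implicit. Unset Printing Implicit Defensive.
Import GRing.Theory Num.Theory.

(* Schur multiplier M(G) = H^2(G, C^x) with trivial action.  We use the
   algebraic complex numbers algC for C (H^2(G, algC^x) = H^2(G, C^x) for
   finite G).  Cochains are arbitrary functions gT -> gT -> algC; only their
   values on G x G matter. *)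

Open Scope ring_scope.

Definition cocycle2 (gT : finGroupType) (G : {set gT})
    (f : gT -> gT -> algC) : Prop :=
  (forall x y, x \in G -> y \in G -> f x y != 0) /\
  (forall x y z, x \in G -> y \in G -> z \in G ->
     f x y * f (x * y)%g z = f y z * f x (y * z)%g).

Definition cohomologous (gT : finGroupType) (G : {set gT})
    (f f' : gT -> gT -> algC) : Prop :=
  exists g : gT -> algC,
    (forall x, x \in G -> g x != 0) /\
    (forall x y, x \in G -> y \in G ->
       f' x y = f x y * (g x * g y / g (x * y)%g)).

Definition schur_multiplier_order (gT : finGroupType) (G : {set gT})
    (n : nat) : Prop :=
  exists s : seq (gT -> gT -> algC),
    [/\ size s = n,
        (forall i, (i < n)%N -> cocycle2 G (nth (fun _ _ => 0) s i)),
        (forall i j, (i < n)%N -> (j < n)%N ->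
           cohomologous G (nth (fun _ _ => 0) s i) (nth (fun _ _ => 0) s j) ->
           i = j) &
        (forall f, cocycle2 G f ->
           exists2 i, (i < n)%N & cohomologous G f (nth (fun _ _ => 0) s i))].

Close Scope ring_scope.

(* Main.v *)
(* Write M(G) for the multiplier and, for a cocycle f, put
   alt f x y = f x y / f y x; on commuting pairs this is bimultiplicative,
   invariant under conjugation and depends only on the class of f.  For a
   central subgroup A of order p contained in G', Ganea's sequence gives
   p |M(G)| <= |M(G / A)| |G : N| as soon as alt f vanishes on N x A for every
   f.  When |G| = p^5 and |Z(G)| = p^2, |G'| is p^2 or p^3, and this yields
   |M(G)| <= p^4 in each of the following cases: |G'| = p^3 (take N = G'
   repeatedly); |G'| = p^2 and G' not central (A = [G', G] and N = C(G'));
   G' = Z(G) with some x^p != 1 (A = <x^p> and N generated by x and the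
   elements of order p).  In the remaining case G' = Z(G) and G has exponent p;
   then G is an explicit group on F_p^5, and a six-parameter family of
   polynomial cocycles, told apart by alt, shows |M(G)| >= p^6. *)

Require Import Defs.
From HB Require Import structures.
From mathcomp Require Import all_boot all_order all_algebra all_fingroup all_solvable all_field.
From mathcomp Require Import ring.

Set Implicit Arguments.
Unset Strict Implicit.
Unset Printing Implicit Defensive.

(** * Cocycles and the alternating pairing *)

Section Cocycles.
Import GRing.Theory.
Local Open Scope ring_scope.
Variables (gT : finGroupType) (G : {group gT}).
Implicit Types (f : gT -> gT -> algC) (h : gT -> algC) (x y z : gT).

(** A cocycle [f] is read as a central extension of [G] by the units of [algC] with lifts satisfying
    u_x u_y = f x y u_(xy). For commuting [x] and [y], [alt f x y] is the commutator of their lifts,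
    which explains its properties. M(G) is never built as a group: upper bounds concern finite
    families of pairwise non-cohomologous cocycles, so Ganea's sequence becomes a pigeonhole count.
    The factor p on its left comes from the characters of A: for A inside G' no nontrivial one
    extends to G, so their transgressions are p classes on G / A that die on G. When |G'| = p^2, the
    quotient G / A has order p^4 and derived subgroup of order p, whence |M(G / A)| <= p^4; all the
    work is then to find N of index at most p. In the exceptional exponent p case the order jumps
    past p^5 to at least p^6. *)

Definition cobound h x y := h x * h y / h (x * y)%g.

Definition alt f x y := f x y / f y x.

Lemma cobound_cocycle h :
  (forall x, x \in G -> h x != 0) -> cocycle2 G (cobound h).
Proof.
move=> h0; split=> [x y Gx Gy | x y z Gx Gy Gz]; rewrite /cobound.
  by rewrite !mulf_neq0 ?invr_eq0 ?h0 ?groupM.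
rewrite mulgA; have := h0 _ (groupM Gx Gy); have := h0 _ (groupM Gy Gz).
by have := h0 _ (groupM (groupM Gx Gy) Gz) => ? ? ?; field; do ?[apply/andP; split].
Qed.

Lemma mul_cocycle f f' :
  cocycle2 G f -> cocycle2 G f' -> cocycle2 G (fun x y => f x y * f' x y).
Proof.
move=> [f0 fA] [f'0 f'A]; split=> [x y Gx Gy | x y z Gx Gy Gz].
  by rewrite mulf_neq0 ?f0 ?f'0.
by rewrite mulrACA fA // f'A // mulrACA.
Qed.

Lemma inv_cocycle f : cocycle2 G f -> cocycle2 G (fun x y => (f x y)^-1).
Proof.
move=> [f0 fA]; split=> [x y Gx Gy | x y z Gx Gy Gz].
  by rewrite invr_eq0 f0.
by rewrite -!invfM fA.
Qed.

Lemma cohomologous_sym f f' : cohomologous G f f' -> cohomologous G f' f.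
Proof.
case=> h [h0 Eh]; exists (fun x => (h x)^-1).
split=> [x Gx | x y Gx Gy]; first by rewrite invr_eq0 h0.
rewrite Eh // invrK; have := h0 _ Gx; have := h0 _ Gy.
by have := h0 _ (groupM Gx Gy) => ? ? ?; field; do ?[apply/andP; split].
Qed.

Lemma cohomologous_trans f1 f2 f3 :
  cohomologous G f1 f2 -> cohomologous G f2 f3 -> cohomologous G f1 f3.
Proof.
case=> h [h0 Eh] [k [k0 Ek]]; exists (fun x => h x * k x).
split=> [x Gx | x y Gx Gy]; first by rewrite mulf_neq0 ?h0 ?k0.
rewrite Ek // Eh //; have := h0 _ (groupM Gx Gy); have := k0 _ (groupM Gx Gy).
by move=> ? ?; field; do ?[apply/andP; split].
Qed.

Lemma cohomologous_alt f f' x y :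
  cohomologous G f f' -> x \in G -> y \in G -> commute x y ->
  alt f' x y = alt f x y.
Proof.
case=> h [h0 Eh] Gx Gy cxy; rewrite /alt !Eh // -cxy invfM mulrACA.
rewrite (mulrC (h y)) divff ?mulr1 //.
by rewrite !mulf_neq0 ?invr_eq0 ?h0 ?groupM.
Qed.

Section Alt.
Variable f : gT -> gT -> algC.
Hypothesis cocf : cocycle2 G f.

Lemma alt_neq0 x y : x \in G -> y \in G -> alt f x y != 0.
Proof. by case: cocf => f0 _ Gx Gy; rewrite mulf_neq0 ?invr_eq0 ?f0. Qed.

Lemma altxx x : x \in G -> alt f x x = 1.
Proof. by case: cocf => f0 _ Gx; rewrite /alt divff ?f0. Qed.

Lemma altV x y : (alt f x y)^-1 = alt f y x.
Proof. by rewrite /alt invfM invrK mulrC. Qed.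

Lemma altMl x y z : x \in G -> y \in G -> z \in G ->
  commute x z -> commute y z -> alt f (x * y)%g z = alt f x z * alt f y z.
Proof.
case: cocf => f0 fA Gx Gy Gz cxz cyz.
(* The cocycle identity with [z] placed last, in the middle and first; commutation with [z]
   identifies the products that occur. *)
have e1 := fA x y z Gx Gy Gz; have e2 := fA x z y Gx Gz Gy.
have e3 := fA z x y Gz Gx Gy.
rewrite -cyz in e2; rewrite -cxz in e3.
have n1 := f0 _ _ Gx Gy; have n2 := f0 _ _ Gz Gy; have n3 := f0 _ _ Gz Gx.
have n4 := f0 _ _ Gz (groupM Gx Gy); have n5 := f0 _ _ Gx (groupM Gy Gz).
have n6 := f0 _ _ (groupM Gx Gz) Gy.
have E1 : f (x * y)%g z = f y z * f x (y * z)%g / f x y by rewrite -e1 mulrC mulKf.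
have E2 : f x (y * z)%g = f x z * f (x * z)%g y / f z y.
  by rewrite e2 mulrC mulKf.
have E3 : f (x * z)%g y = f x y * f z (x * y)%g / f z x.
  by rewrite -e3 mulrC mulKf.
by rewrite /alt E1 E2 E3; field; do ?[apply/andP; split].
Qed.

Lemma altMr x y z : x \in G -> y \in G -> z \in G ->
  commute x y -> commute x z -> alt f x (y * z)%g = alt f x y * alt f x z.
Proof.
move=> Gx Gy Gz cxy cxz.
by rewrite -altV altMl //; [rewrite invfM !altV | apply: commute_sym..].
Qed.

Lemma alt1l x : x \in G -> alt f 1%g x = 1.
Proof.
move=> Gx; have := alt_neq0 (group1 G) Gx => n0.
apply: (mulfI n0); rewrite mulr1 -altMl ?mul1g //; exact/commute_sym/commute1.
Qed.

Lemma altXl x y n : x \in G -> y \in G -> commute x y ->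
  alt f (x ^+ n)%g y = alt f x y ^+ n.
Proof.
move=> Gx Gy cxy; elim: n => [|n IHn]; first by rewrite expr0 expg0 alt1l.
rewrite expgS altMl ?groupX // ?IHn ?exprS //.
by apply: commute_sym; apply: commuteX; apply: commute_sym.
Qed.

Lemma alt_powl x n : x \in G -> alt f x (x ^+ n)%g = 1.
Proof. by move=> Gx; rewrite -altV altXl // altxx // expr1n invr1. Qed.

Lemma altVl x y : x \in G -> y \in G -> commute x y ->
  alt f x^-1%g y = (alt f x y)^-1.
Proof.
move=> Gx Gy cxy; apply: (mulfI (alt_neq0 Gx Gy)).
rewrite -altMl ?groupV ?mulgV ?alt1l ?divff ?alt_neq0 //.
by apply: commute_sym; apply: commuteV; apply: commute_sym.
Qed.

(** For fixed [z], [alt f] is a character on the elements commuting with [z], and characters kill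
    commutators. *)
Lemma alt_commg x y z : x \in G -> y \in G -> z \in G ->
  commute x z -> commute y z -> alt f [~ x, y]%g z = 1.
Proof.
move=> Gx Gy Gz cxz cyz.
have cxV : commute x^-1%g z by apply/commute_sym/commuteV/commute_sym.
have cyV : commute y^-1%g z by apply/commute_sym/commuteV/commute_sym.
have cxy : commute (x * y)%g z.
  by apply/commute_sym/commuteM; apply/commute_sym.
have cyx : commute (y^-1 * (x * y))%g z.
  by apply/commute_sym/commuteM; apply/commute_sym.
rewrite commgEl /conjg !altMl ?altVl ?groupM ?groupV //.
by field; rewrite !alt_neq0.
Qed.

Lemma alt_conj x y z : x \in G -> y \in G -> z \in G -> commute x y ->
  alt f (x ^ z)%g (y ^ z)%g = alt f x y.
Proof.
case: cocf => f0 fA Gx Gy Gz cxy.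
(* Conjugation by [z] changes [f] by the coboundary of [u => f z (u ^ z) / f u z]; on a commuting
   pair this factor is symmetric and cancels in the quotient. *)
have step u v : u \in G -> v \in G ->
    f (u ^ z)%g (v ^ z)%g * f z (u ^ z * v ^ z)%g =
    f u v * (f z (u ^ z)%g / f u z * (f z (v ^ z)%g / f v z) * f (u * v)%g z).
  move=> Gu Gv; have Guz : (u ^ z)%g \in G by rewrite groupJ.
  have Gvz : (v ^ z)%g \in G by rewrite groupJ.
  have zu w : (z * w ^ z = w * z)%g by rewrite -conjgC.
  have := fA _ _ _ Gz Guz Gvz; rewrite zu => e1.
  have := fA _ _ _ Gu Gz Gvz; rewrite zu => e2.
  have e3 := fA _ _ _ Gu Gv Gz.
  have n1 := f0 _ _ Gu Gz; have n2 := f0 _ _ Gv Gz.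
  have E2 : f (u * z)%g (v ^ z)%g = f z (v ^ z)%g * f u (v * z)%g / f u z.
    by rewrite -e2 mulrC mulKf.
  have E3 : f u (v * z)%g = f u v * f (u * v)%g z / f v z.
    by rewrite e3 mulrC mulKf.
  by rewrite -e1 E2 E3; field; do ?[apply/andP; split].
have := step _ _ Gy Gx; have := step _ _ Gx Gy.
rewrite -!conjMg -cxy /alt.
set c := f z _; set k := (X in _ * X = _ -> _ -> _).
have Gxy := groupM Gx Gy.
have c0 : c != 0 by rewrite f0 ?groupJ.
move=> e1 e2.
have -> : f (x ^ z)%g (y ^ z)%g =
    f x y * (f z (x ^ z)%g / f x z * (f z (y ^ z)%g / f y z) * f (x * y)%g z) / c.
  by rewrite -e1 mulfK.
have -> : f (y ^ z)%g (x ^ z)%g =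
    f y x * (f z (y ^ z)%g / f y z * (f z (x ^ z)%g / f x z) * f (x * y)%g z) / c.
  by rewrite -e2 mulfK.
have n1 := f0 _ _ Gx Gz; have n2 := f0 _ _ Gy Gz; have n3 := f0 _ _ Gxy Gz.
have n4 : f z (x ^ z)%g != 0 by rewrite f0 ?groupJ.
have n5 : f z (y ^ z)%g != 0 by rewrite f0 ?groupJ.
have n6 := f0 _ _ Gy Gx.
by field; do ?[apply/andP; split].
Qed.

End Alt.
End Cocycles.

(** * Pigeonhole for characters *)

Lemma large_fiber (I J : finType) (S : {set I}) (k : I -> J) (j0 : J) :
  exists j, #|S| <= #|[set i in S | k i == j]| * #|J|.
Proof.
pose F j := #|[set i in S | k i == j]|.
exists [arg max_(j > j0) F j]; case: arg_maxnP => // j _ maxj.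
rewrite -sum1_card (partition_big k predT) //= mulnC -sum_nat_const.
apply: leq_sum => i _; apply: leq_trans (maxj i isT); rewrite /F -sum1_card.
by rewrite eq_leq //; apply: eq_bigl => l; rewrite inE.
Qed.

Section Homs.
Import GRing.Theory.
Local Open Scope ring_scope.
Variables (gT : finGroupType) (G : {group gT}).

Section Kernel.
Variable c : gT -> algC.
Hypothesis c0 : forall x, x \in G -> c x != 0.
Hypothesis cM : forall x y, x \in G -> y \in G -> c (x * y)%g = c x * c y.

Lemma hom1 : c 1%g = 1.
Proof.
by apply: (mulfI (c0 (group1 G))); rewrite -cM ?group1 // mulg1 mulr1.
Qed.

Lemma homV x : x \in G -> c x^-1%g = (c x)^-1.
Proof.
move=> Gx; apply: (mulfI (c0 Gx)).
by rewrite -cM ?groupV // mulgV hom1 divff ?c0.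
Qed.

Lemma hom_ker_group_set : group_set [set x in G | c x == 1].
Proof.
apply/group_setP; split=> [|x y]; first by rewrite inE group1 hom1 /=.
rewrite !inE => /andP[Gx /eqP cx] /andP[Gy /eqP cy].
by rewrite groupM // cM // cx cy mulr1 /=.
Qed.

Lemma hom_der1 x : x \in G^`(1)%g -> c x = 1.
Proof.
have sK : G^`(1)%g \subset Group hom_ker_group_set.
  rewrite gen_subG; apply/subsetP=> _ /imset2P[u v Gu Gv ->].
  rewrite inE groupR //= commgEl /conjg !cM ?groupM ?groupV // !homV //.
  have := c0 Gu; have := c0 Gv => ? ?.
  by apply/eqP; field; do ?[apply/andP; split].
by move/(subsetP sK); rewrite inE => /andP[_ /eqP].
Qed.

End Kernel.

(* Pigeonhole form of: a homomorphism from N to the p-th roots of unity has at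
   most |G : N| extensions to G. *)
Lemma hom_fiber (p : nat) (N : {group gT}) (I : finType) (chi : I -> gT -> algC)
    (S : {set I}) :
  prime p -> (p.-group G)%g -> N \subset G ->
  (forall i x y, x \in G -> y \in G -> chi i (x * y)%g = chi i x * chi i y) ->
  (forall i x, x \in G -> chi i x ^+ p = 1) ->
  (forall i j x, i \in S -> j \in S -> x \in N -> chi i x = chi j x) ->
  exists S' : {set I},
    [/\ S' \subset S, (#|S| <= #|S'| * #|G : N|%g)%N &
        forall i j x, i \in S' -> j \in S' -> x \in G -> chi i x = chi j x].
Proof.
move=> pr_p pG sNG chiM chip.
have chi0 i x : x \in G -> chi i x != 0.
  move=> Gx; apply/eqP=> x0; have := chip i x Gx; rewrite x0 expr0n.
  by rewrite (negbTE (lt0n_neq0 (prime_gt0 pr_p))) => /esym/eqP; rewrite oner_eq0.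
(* Induction on the index: adjoin some [x] outside [N] and keep the most frequent of the [p]
   possible values of [chi i x]. This costs a factor [p], while the index drops by a factor at least
   [p]. *)
have [n leGn] := ubnP #|G : N|%g; elim: n => // n IHn in N S leGn sNG *.
move=> agr; have [sGN | /subsetPn[x Gx nNx]] := boolP (G \subset N).
  exists S; split=> //.
    by rewrite (_ : #|G : N|%g = 1)%N ?muln1 //; apply/eqP; rewrite indexg_eq1.
  by move=> i j x Si Sj /(subsetP sGN); apply: agr.
have [z prz] := C_prim_root_exists (prime_gt0 pr_p).
pose j0 := Ordinal (prime_gt0 pr_p).
pose k i := odflt j0 [pick k : 'I_p | chi i x == z ^+ k].
have kE i : chi i x = z ^+ k i.
  rewrite /k; case: pickP => [l /eqP // | none].
  have [l El] := prim_rootP prz (chip i x Gx).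
  by have := none l; rewrite El eqxx.
have [l le_l] := large_fiber S k j0.
set S1 := [set i in S | _] in le_l.
pose N1 := <<x |: N>>%G.
have sN1G : N1 \subset G by rewrite gen_subG subUset sub1set Gx.
have sNN1 : N \subset N1 by rewrite (subset_trans (subsetUr [set x] N)) ?subset_gen.
have leN1 : (p <= #|N1 : N|%g)%N.
  have pN1 : p.-nat #|N1 : N|%g by apply: pnat_dvd (dvdn_indexg _ _) (pgroupS sN1G pG).
  have : (1 < #|N1 : N|%g)%N.
    by rewrite indexg_gt1; apply/subsetPn; exists x; rewrite // mem_gen ?setU11.
  have [[|e] ->] := p_natP pN1; first by [].
  move=> _.
  by rewrite expnS leq_pmulr // expn_gt0 prime_gt0.
have idx := Lagrange_index sN1G sNN1.
case: (IHn N1 S1) => // [||S' [sS' leS' agr']].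
- rewrite -ltnS (leq_trans _ leGn) // ltnS -idx -{1}[#|G : N1|%g]muln1.
  by rewrite ltn_pmul2l ?indexg_gt0 // (leq_trans (prime_gt1 pr_p)).
- move=> i j y; rewrite !inE => /andP[Si /eqP ki] /andP[Sj /eqP kj].
  pose c u := chi i u / chi j u.
  have c0 u : u \in G -> c u != 0 by move=> Gu; rewrite mulf_neq0 ?invr_eq0 ?chi0.
  have cM u v : u \in G -> v \in G -> c (u * v)%g = c u * c v.
    by move=> Gu Gv; rewrite /c !chiM // invfM mulrACA.
  suff sK : N1 \subset Group (hom_ker_group_set c0 cM).
    move/(subsetP sK); rewrite inE => /andP[Gy /eqP cy].
    by rewrite -[LHS](divfK (chi0 j y Gy)) -/(c y) cy mul1r.
  rewrite gen_subG; apply/subsetP=> u /setU1P[-> | Nu].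
    by rewrite inE Gx /c !kE ki kj divff ?eqxx // -kj -kE chi0.
  by rewrite inE (subsetP sNG) //= /c (agr i j u) // divff ?chi0 ?(subsetP sNG).
exists S'; split=> //.
  by rewrite (subset_trans sS') //; apply/subsetP=> i; rewrite inE => /andP[].
rewrite card_ord in le_l; apply: (leq_trans le_l).
rewrite -idx (leq_trans (leq_mul leS' leN1)) // mulnA //.
Qed.

End Homs.

(** * Inflation from a central quotient *)

Section Inflation.
Import GRing.Theory Num.Theory.
Local Open Scope ring_scope.
Variable gT : finGroupType.
Implicit Types (a b x y : gT) (f : gT -> gT -> algC).

Definition cyclog a x : nat :=
  odflt (Ordinal (order_gt0 a)) [pick i : 'I_#[a]%g | (a ^+ i)%g == x].

Lemma cyclogK a x : x \in <[a]>%g -> (a ^+ cyclog a x)%g = x.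
Proof.
rewrite /cyclog => /cyclePmin[i lti ->]; case: pickP => [j /eqP // | none].
by have := none (Ordinal lti); rewrite eqxx.
Qed.

Lemma cyclog_mod a i : cyclog a (a ^+ i)%g = i %[mod #[a]%g].
Proof. by apply/eqP; rewrite -eq_expg_mod_order cyclogK ?mem_cycle. Qed.

Lemma cocycle_x1 (G : {group gT}) f x :
  cocycle2 G f -> x \in G -> f x 1%g = f 1%g 1%g.
Proof.
case=> f0 fA Gx; have := fA x 1%g 1%g Gx (group1 G) (group1 G).
by rewrite !mulg1; apply: mulIf; rewrite f0 ?group1.
Qed.

(* A central extension by algC^* splits over a cyclic group: the powers of a
   lift of the generator, rescaled by an n-th root, give a section. *)
Lemma cyclic_trivial (G : {group gT}) f a :
  cocycle2 G f -> a \in G ->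
  exists mu : gT -> algC,
    (forall b, b \in <[a]>%g -> mu b != 0) /\
    (forall b c, b \in <[a]>%g -> c \in <[a]>%g ->
       mu (b * c)%g = mu b * mu c * f b c).
Proof.
move=> cocf Ga; have [f0 fA] := cocf.
(* [P i] compares the [i]-th power of the lift of [a] with the lift of [a ^+ i]; it starts at
   [(f 1 1)^-1] because [f] is not normalized. *)
pose P := fix P i := if i is j.+1 then P j * f (a ^+ j)%g a else (f 1%g 1%g)^-1.
have P0 i : P i != 0.
  by elim: i => [|i IHi] /=; rewrite ?invr_eq0 ?mulf_neq0 ?f0 ?groupX.
(* Rescaled by [l], the lift of [a] has trivial [n]-th power, so [s] becomes periodic modulo [n]. *)
pose n := #[a]%g; pose l := n.-root (P 0%N / P n).
have ln : l ^+ n * P n = P 0%N by rewrite rootCK ?order_gt0 // divfK.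
have l0 : l != 0.
  apply/eqP=> l0; move: ln; rewrite l0 expr0n (negbTE (lt0n_neq0 (order_gt0 a))).
  by rewrite mul0r => /esym/eqP; rewrite (negbTE (P0 0%N)).
pose s i := l ^+ i * P i.
have sD i j : s (i + j)%N = s i * s j * f (a ^+ i)%g (a ^+ j)%g.
  elim: j => [|j IHj].
    rewrite addn0 expg0 (cocycle_x1 cocf) ?groupX //.
    by rewrite {3}/s expr0 mul1r -mulrA mulVf ?mulr1 ?f0.
  have -> : s (i + j.+1)%N = s (i + j)%N * l * f (a ^+ (i + j))%g a.
    by rewrite /s addnS exprS /=; ring.
  have -> : s j.+1 = s j * l * f (a ^+ j)%g a by rewrite /s exprS /=; ring.
  rewrite IHj expgD expgSr -!mulrA; congr (_ * (_ * _)).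
  rewrite !(mulrCA _ l); congr (_ * _); rewrite fA ?groupX //.
have sn i : s (i + n)%N = s i.
  rewrite sD expg_order -(expg0 a) {2}/s ln -[P 0%N]mul1r -(expr0 l) -/(s 0%N).
  by rewrite -sD addn0.
have smod i j : i = j %[mod n] -> s i = s j.
  have sm k : s k = s (k %% n)%N.
    rewrite {1}(divn_eq k n) addnC; elim: (k %/ n)%N => [|m IHm].
      by rewrite mul0n addn0.
    by rewrite mulSn addnCA addnC sn.
  by move=> eij; rewrite sm eij -sm.
exists (fun b => s (cyclog a b)); split=> [b _ | b c Ab Ac].
  by rewrite mulf_neq0 ?expf_neq0.
rewrite -{3}(cyclogK Ab) -{3}(cyclogK Ac) -sD; apply: smod.
by rewrite -{1}(cyclogK Ab) -{1}(cyclogK Ac) -expgD cyclog_mod.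
Qed.

Definition invariant_mod (G A : {set gT}) f := forall x y b,
  x \in G -> y \in G -> b \in A -> f (x * b)%g y = f x y /\ f x (y * b)%g = f x y.

Variables (G A : {group gT}).
Hypothesis sAZ : A \subset 'Z(G)%g.

Let sAG : A \subset G. Proof. exact: subset_trans sAZ (center_sub G). Qed.
Let nAG : G \subset 'N(A)%g.
Proof. exact: (normal_norm (sub_center_normal sAZ)). Qed.

Let cAG b x : b \in A -> x \in G -> commute x b.
Proof. by move/(subsetP sAZ)/centerP=> [_ cb] Gx; apply/commute_sym/cb. Qed.

Definition crepr x : gT := repr (x *: A)%g.
Definition cpart x : gT := ((crepr x)^-1 * x)%g.

Lemma crepr_in x : x \in G -> crepr x \in G.
Proof.
move=> Gx; have /lcosetP[b Ab ->] : crepr x \in (x *: A)%g.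
  by apply: (mem_repr x); rewrite lcoset_refl.
by rewrite groupM // (subsetP sAG).
Qed.

Lemma cpart_in x : cpart x \in A.
Proof.
have : crepr x \in (x *: A)%g by apply: (mem_repr x); rewrite lcoset_refl.
by rewrite lcoset_sym mem_lcoset.
Qed.

Lemma cparteq x : x = (crepr x * cpart x)%g.
Proof. by rewrite /cpart mulKVg. Qed.

Lemma creprM x b : b \in A -> crepr (x * b)%g = crepr x.
Proof. by move=> Ab; rewrite /crepr lcosetM lcoset_id. Qed.

Lemma cpartM x b : b \in A -> cpart (x * b)%g = (cpart x * b)%g.
Proof. by move=> Ab; rewrite /cpart creprM // mulgA. Qed.

(** The extension splits over the cyclic group [A] through [mu], and trivial pairing makes the lifts
    of [A] central. Multiplying the lift of a coset representative by the split lift of the part in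
    [A] gives new lifts, encoded by [h], whose cocycle no longer sees [A]. *)
Lemma inflation f : cocycle2 G f -> cyclic A ->
  (forall x b, x \in G -> b \in A -> alt f x b = 1) ->
  exists h : gT -> algC, (forall x, x \in G -> h x != 0) /\
    invariant_mod G A (fun x y => f x y * cobound h x y).
Proof.
move=> cocf /cyclicP[a defA] altA; have [f0 fA] := cocf.
have Aa : a \in A by rewrite defA cycle_id.
have [mu [mu0 muM]] := cyclic_trivial cocf (subsetP sAG a Aa).
rewrite -defA in mu0 muM.
have Ain b : b \in A -> b \in G by apply: (subsetP sAG).
have fC x b : x \in G -> b \in A -> f x b = f b x.
  by move=> Gx Ab; rewrite -[LHS](divfK (f0 b x (Ain _ Ab) Gx)) -/(alt f x b) altA ?mul1r.
pose h x := mu (cpart x) * f (crepr x) (cpart x).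
have h0 x : x \in G -> h x != 0.
  by move=> Gx; rewrite mulf_neq0 ?mu0 ?cpart_in ?f0 ?crepr_in // Ain ?cpart_in.
have hM x b : x \in G -> b \in A -> h (x * b)%g = h x * mu b * f x b.
  move=> Gx Ab; rewrite /h creprM // cpartM // muM ?cpart_in //.
  have := fA (crepr x) (cpart x) b (crepr_in Gx) (Ain _ (cpart_in x)) (Ain _ Ab).
  rewrite -cparteq => e; rewrite -!mulrA; congr (_ * _).
  by rewrite [RHS]mulrCA e.
exists h; split=> // x y b Gx Gy Ab; rewrite /cobound.
have Gb := Ain _ Ab; have Gxy := groupM Gx Gy.
have E1 : f x (y * b)%g = f x y * f (x * y)%g b / f y b.
  by rewrite fA // mulrC mulKf ?f0.
have E2 : f (x * b)%g y = f x y * f (x * y)%g b / f x b.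
  apply: (mulIf (f0 _ _ Gx Gb)); rewrite divfK ?f0 // mulrC fA // -fC //.
  by rewrite -(cAG Ab Gy) -fA.
have nb := mu0 _ Ab; have nxb := f0 _ _ Gx Gb; have nyb := f0 _ _ Gy Gb.
have nxyb := f0 _ _ Gxy Gb; have hxy := h0 _ Gxy.
split.
  rewrite -mulgA -(cAG Ab Gy) mulgA (hM x) // (hM (x * y)%g) // E2.
  by field; do ?[apply/andP; split].
by rewrite mulgA (hM y) // (hM (x * y)%g) // E1; field; do ?[apply/andP; split].
Qed.

Definition descend f (X Y : coset_of A) := f (repr X) (repr Y).

Lemma descendE f x y : invariant_mod G A f -> x \in G -> y \in G ->
  descend f (coset A x) (coset A y) = f x y.
Proof.
move=> invf Gx Gy; have rep z : z \in G -> exists2 b, b \in A & repr (coset A z) = (z * b)%g.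
  move=> Gz; have Nz := subsetP nAG z Gz.
  have : repr (coset A z) \in (A :* z)%g.
    by apply/rcoset_kercosetP; rewrite ?repr_coset_norm ?coset_reprK.
  rewrite norm_rlcoset //; case/lcosetP=> b Ab ->; by exists b.
have [b Ab Eb] := rep x Gx; have [c Ac Ec] := rep y Gy.
rewrite /descend Eb Ec; have Gyc : (y * c)%g \in G by rewrite groupM // (subsetP sAG).
by rewrite (proj1 (invf _ _ _ Gx Gyc Ab)) (proj2 (invf _ _ _ Gx Gy Ac)).
Qed.

Lemma descend_cocycle f : cocycle2 G f -> invariant_mod G A f ->
  cocycle2 (G / A)%g (descend f).
Proof.
move=> [f0 fA] invf; split=> [_ _ /morphimP[x _ Gx ->] /morphimP[y _ Gy ->] |].
  by rewrite descendE ?f0.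
move=> _ _ _ /morphimP[x Nx Gx ->] /morphimP[y Ny Gy ->] /morphimP[z Nz Gz ->].
by rewrite -!morphM //= !descendE ?groupM ?fA.
Qed.

(** The cochain pulled back from [G / A] is constant on [A]; this constancy later separates the
    characters of [A] when the kernel of inflation is counted. *)
Lemma descend_cohomologous f f' : invariant_mod G A f -> invariant_mod G A f' ->
  cohomologous (G / A)%g (descend f) (descend f') ->
  exists h : gT -> algC, [/\ forall x, x \in G -> h x != 0,
    forall b, b \in A -> h b = h 1%g &
    forall x y, x \in G -> y \in G -> f' x y = f x y * cobound h x y].
Proof.
move=> invf invf' [h [h0 E]]; exists (fun x => h (coset A x)); split=> [x Gx|b Ab|x y Gx Gy].
- by rewrite h0 // mem_quotient.
- by rewrite coset_id // morph1.
rewrite -(descendE invf' Gx Gy) E ?mem_quotient // descendE //.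
by rewrite /cobound morphM ?(subsetP nAG).
Qed.

End Inflation.

(** * Upper bounds through a central quotient *)

Section Bound.
Import GRing.Theory.
Local Open Scope ring_scope.

(** Phrased with arbitrary finite families so that a bound for a quotient can be used without a list
    of representatives of its classes. *)
Definition multiplier_le (gT : finGroupType) (G : {set gT}) (n : nat) :=
  forall (I : finType) (F : I -> gT -> gT -> algC),
    (forall i, cocycle2 G (F i)) ->
    (forall i j, cohomologous G (F i) (F j) -> i = j) -> (#|I| <= n)%N.

Lemma multiplier_leW (gT : finGroupType) (G : {set gT}) m n :
  (m <= n)%N -> multiplier_le G m -> multiplier_le G n.
Proof. by move=> le_mn leGm I F cocF injF; apply: leq_trans (leGm I F cocF injF) le_mn. Qed.

Lemma multiplier_le_order (gT : finGroupType) (G : {set gT}) m n :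
  schur_multiplier_order G m -> multiplier_le G n -> (m <= n)%N.
Proof.
case=> s [_ cocs injs _] leGn; rewrite -(card_ord m).
apply: (leGn _ (fun i : 'I_m => nth (fun _ _ => 0) s i)) => [i | i j cij].
  exact: cocs.
by apply: val_inj; apply: injs cij.
Qed.

(** Serves the exponent p case, where the lower bound is stated for every [n] satisfying
    [multiplier_le G n]. *)
Lemma order_multiplier_le (gT : finGroupType) (G : {group gT}) n :
  schur_multiplier_order G n -> multiplier_le G n.
Proof.
case=> s [_ _ _ surs] I F cocF injF.
have [k kP] : exists k : I -> 'I_n, forall i,
    cohomologous G (F i) (nth (fun _ _ => 0) s (k i)).
  apply: (@fin_all_exists I (fun=> 'I_n) (fun i k =>
    cohomologous G (F i) (nth (fun _ _ => 0) s k))) => i.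
  by have [k ltk ck] := surs _ (cocF i); exists (Ordinal ltk).
rewrite -(card_ord n); apply: (leq_card k) => i j eij; apply: injF.
by apply: (cohomologous_trans (kP i)); rewrite eij; apply/cohomologous_sym/kP.
Qed.

(* The Ganea sequence for a central subgroup A of order p: a cocycle pairs
   G / N with A, those with trivial pairing are inflated from G / A, and the
   kernel of inflation has order at least |A :&: G'|. *)
Lemma central_step (gT : finGroupType) (G A N : {group gT}) p m :
    prime p -> (p.-group G)%g -> A \subset 'Z(G)%g -> #|A| = p -> N \subset G ->
    (forall f, cocycle2 G f ->
       forall x a, x \in N -> a \in A -> alt f x a = 1) ->
    multiplier_le (G / A)%g m ->
  multiplier_le G (m * #|G : N|%g %/ #|A :&: G^`(1)%g|)%N.
Proof.
move=> pr_p pG sAZ oA sNG altN leGA I F cocF injF.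
rewrite leq_divRL ?cardG_gt0 //; set q := #|A :&: _|.
have q_le : (q <= p)%N by rewrite -oA subset_leq_card ?subsetIl.
have sAG : A \subset G := subset_trans sAZ (center_sub G).
have cA : cyclic A by rewrite prime_cyclic ?oA.
have [a defA] := cyclicP cA.
have oa : #[a]%g = p by rewrite /order -defA.
have Aa : a \in A by rewrite defA cycle_id.
have Ga := subsetP sAG a Aa.
have cAG x b : x \in G -> b \in A -> commute x b.
  by move=> Gx /(subsetP sAZ)/centerP[_ cb]; apply/commute_sym/cb.
pose chi i x := alt (F i) x a.
have chiM i x y : x \in G -> y \in G -> chi i (x * y)%g = chi i x * chi i y.
  by move=> Gx Gy; rewrite /chi (altMl (cocF i)) //; apply: cAG.
have chip i x : x \in G -> chi i x ^+ p = 1.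
  move=> Gx; rewrite /chi -altV exprVn -(altXl (cocF i)) //; last exact/commute_sym/cAG.
  by rewrite -oa expg_order (alt1l (cocF i)) ?invr1.
(* On [S], at least a fraction [1 / |G : N|] of the family, all pairings with [A] agree; dividing by
   one member [i0] then makes them trivial. *)
have [|S [_ leS chiS]] := hom_fiber (S := [set: I]) pr_p pG sNG chiM chip.
  by move=> i j x _ _ Nx; rewrite /chi !altN.
rewrite cardsT in leS; have [S0 | [i0 Si0]] := set_0Vmem S.
  by move: leS; rewrite S0 cards0 mul0n leqn0 => /eqP ->.
pose D i x y := F i x y * (F i0 x y)^-1.
have cocD i : cocycle2 G (D i) by apply: mul_cocycle (inv_cocycle _).
have altD i x b : i \in S -> x \in G -> b \in A -> alt (D i) x b = 1.
  move=> Si Gx; rewrite defA => /cycleP[k ->]; have cxa := cAG x a Gx Aa.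
  rewrite -altV (altXl (cocD i)) //.
  have -> : alt (D i) a x = (chi i x)^-1 * chi i0 x.
    by rewrite /alt /D /chi /alt !invfM !invrK; ring.
  rewrite (chiS i i0) // mulVf ?expr1n ?invr1 // (alt_neq0 (cocF _)) //.
have [g gP] : exists g : I -> gT -> algC, forall i, i \in S ->
    (forall x, x \in G -> g i x != 0) /\
    invariant_mod G A (fun x y => D i x y * cobound (g i) x y).
  apply: (@fin_all_exists I (fun=> gT -> algC) (fun i g => i \in S ->
    (forall x, x \in G -> g x != 0) /\
    invariant_mod G A (fun x y => D i x y * cobound g x y))) => i.
  have [Si | _] := boolP (i \in S); last by exists (fun=> 0).
  by have [g gP] := inflation sAZ (cocD i) cA (fun x b => altD i x b Si); exists g.
have [z prz] := C_prim_root_exists (prime_gt0 pr_p).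
(* [kap] is a faithful character of [A], and [h k] spreads its [k]-th power along the cosets. The
   coboundary of [h k] descends to [G / A]: it is the transgression of that character. *)
pose kap (b : gT) : algC := z ^+ cyclog a b.
have kap0 b : kap b != 0.
  rewrite expf_neq0 //; apply/eqP=> z0; have := prim_expr_order prz.
  by rewrite z0 expr0n (negbTE (lt0n_neq0 (prime_gt0 pr_p))) => /esym/eqP; rewrite oner_eq0.
have kapM b c : b \in A -> c \in A -> kap (b * c)%g = kap b * kap c.
  rewrite defA => Ab Ac; rewrite /kap -exprD; apply/eqP.
  rewrite (eq_prim_root_expr prz) -oa -eq_expg_mod_order expgD !cyclogK ?groupM //.
pose h (k : 'I_q) x := kap (cpart A x) ^+ k.
have h0 k x : h k x != 0 by rewrite expf_neq0.
have hM k x b : b \in A -> h k (x * b)%g = h k x * kap b ^+ k.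
  by move=> Ab; rewrite /h cpartM // kapM ?cpart_in // exprMn.
have hinv k x y b : x \in G -> y \in G -> b \in A ->
    cobound (h k) (x * b)%g y = cobound (h k) x y /\
    cobound (h k) x (y * b)%g = cobound (h k) x y.
  move=> Gx Gy Ab; rewrite /cobound -mulgA -(cAG _ _ Gy Ab) mulgA.
  rewrite (hM k x b) // (hM k y b) // (hM k (x * y)%g b) //.
  have n1 := h0 k (x * y)%g; have n2 := expf_neq0 k (kap0 b).
  by split; field; do ?[apply/andP; split].
(* Each kept cocycle twisted by each of [q] transgressions gives a cocycle on [G / A]; showing these
   pairwise non-cohomologous yields [|S| * q <= m]. *)
pose T := ({i : I | i \in S} * 'I_q)%type.
pose Phi (t : T) x y :=
  D (val t.1) x y * cobound (g (val t.1)) x y * cobound (h t.2) x y.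
have invPhi t : invariant_mod G A (Phi t).
  move=> x y b Gx Gy Ab; have [e1 e2] := proj2 (gP _ (valP t.1)) x y b Gx Gy Ab.
  by have [e3 e4] := hinv t.2 x y b Gx Gy Ab; rewrite /Phi e1 e2 e3 e4.
have cocPhi t : cocycle2 G (Phi t).
  apply: mul_cocycle (cobound_cocycle _) => //; apply: mul_cocycle => //.
  by apply: cobound_cocycle; case: (gP _ (valP t.1)).
have : (#|{: T}| <= m)%N.
  apply: (leGA T (fun t => descend (Phi t))) => [t | [[i Si] k] [[j Sj] l]].
    exact: descend_cocycle.
  move/(descend_cohomologous sAZ (invPhi _) (invPhi _)) => [u [u0 uA Eu]].
  have {}Eu x y : x \in G -> y \in G ->
      F j x y * cobound (g j) x y * cobound (h l) x y =
      F i x y * cobound (g i) x y * cobound (h k) x y * cobound u x y.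
    move=> Gx Gy; have F0 := proj1 (cocF i0) x y Gx Gy.
    have := Eu x y Gx Gy; rewrite /Phi /D /= => e.
    apply: (mulIf (invr_neq0 F0)); apply: etrans (etrans _ e) _; ring.
  have [gi0 _] := gP i Si; have [gj0 _] := gP j Sj.
  have eij : i = j.
    apply: injF; exists (fun x => g i x * h k x * u x / (g j x * h l x)).
    split=> [x Gx | x y Gx Gy].
      by rewrite !mulf_neq0 ?invr_eq0 ?mulf_neq0 ?gi0 ?gj0 ?u0 ?h0.
    have Gxy := groupM Gx Gy; have := Eu x y Gx Gy; rewrite /cobound => e.
    have nz1 := gj0 x Gx; have nz2 := gj0 y Gy; have nz3 := gj0 _ Gxy.
    have nz4 := h0 l x; have nz5 := h0 l y; have nz6 := h0 l (x * y)%g.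
    have nz7 := gi0 _ Gxy; have nz8 := h0 k (x * y)%g; have nz9 := u0 _ Gxy.
    have c0 : g j x * g j y / g j (x * y)%g * (h l x * h l y / h l (x * y)%g) != 0.
      by rewrite !mulf_neq0 ?invr_eq0.
    apply: (mulIf c0); rewrite [LHS]mulrA e.
    by field; do ?[apply/andP; split].
  subst j; have -> : Sj = Si by apply: bool_irrelevance.
  suff -> : k = l by [].
  have [trA | ntA] := eqVneq (A :&: G^`(1)%g) 1%g.
    have q1 : q = 1%N by rewrite /q trA cards1.
    have z0 (i' : 'I_q) : nat_of_ord i' = 0%N.
      by apply/eqP; rewrite -leqn0 -ltnS -[1%N]q1.
    by apply: val_inj; rewrite /= !z0.
  have sAG' : A \subset G^`(1)%g.
    by apply: prime_meetG => //; rewrite oA.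
  (* With [i = j] the cocycles cancel and [c] is a character of [G], hence trivial on [A] inside
     [G']; but its value at [a] is [z ^+ k / z ^+ l]. *)
  pose c x := h k x * u x / h l x.
  have c0 x : x \in G -> c x != 0 by move=> Gx; rewrite !mulf_neq0 ?invr_eq0 ?u0.
  have cM x y : x \in G -> y \in G -> c (x * y)%g = c x * c y.
    move=> Gx Gy; have Gxy := groupM Gx Gy.
    have gg : F i x y * cobound (g i) x y != 0.
      by rewrite !mulf_neq0 ?invr_eq0 ?(proj1 (cocF i)) ?gi0.
    have := Eu x y Gx Gy; rewrite -[RHS](mulrA (F i x y * _)) => /(mulfI gg).
    rewrite /cobound /c => e.
    have nz4 := h0 l x; have nz5 := h0 l y; have nz6 := h0 l (x * y)%g.
    have nz8 := h0 k (x * y)%g; have nz9 := u0 _ Gxy.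
    have w0 : h l x * h l y / h l (x * y)%g != 0 by rewrite !mulf_neq0 ?invr_eq0.
    apply: (mulIf w0); rewrite {1}e.
    by field; do ?[apply/andP; split].
  have kapa : kap a = z.
    apply/eqP; rewrite -[X in _ == X]expr1 (eq_prim_root_expr prz) -oa.
    by rewrite -{2}(expg1 a) cyclog_mod.
  have ha k' : h k' a = h k' 1%g * z ^+ k' by rewrite -kapa -hM ?mul1g.
  have := hom_der1 c0 cM (subsetP sAG' a Aa).
  rewrite -(hom1 c0 cM) /c (uA a Aa) !ha => e.
  have u1 := u0 _ (group1 G); have n1 := h0 k 1%g; have n2 := h0 l 1%g.
  have zl : z ^+ l != 0 by rewrite -kapa expf_neq0.
  have nz : h k 1%g * u 1%g / (h l 1%g * z ^+ l) != 0.
    by rewrite !mulf_neq0 ?invr_eq0 ?mulf_neq0.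
  have /eqP : z ^+ k = z ^+ l.
    apply: (mulIf nz); apply: etrans (etrans _ e) _; field;
    by do ?[apply/andP; split].
  rewrite (eq_prim_root_expr prz) !modn_small ?(leq_trans (ltn_ord _)) //.
  by move/eqP/val_inj.
rewrite /T card_prod card_ord card_sig => leT.
apply: (@leq_trans (#|S| * #|G : N|%g * q)); first by rewrite leq_mul2r leS orbT.
by rewrite mulnAC leq_mul2r leT orbT.
Qed.

End Bound.

(** * Multipliers of small p-groups *)

Section CentralSubgroups.
Import GroupScope.
Variables (gT : finGroupType) (p : nat).
Hypothesis pr_p : prime p.
Implicit Types G H A N : {group gT}.

Lemma multiplier_le_trivial G : G :=: 1 -> multiplier_le G 1.
Proof.
move=> G1 I F cocF injF; apply/fintype_le1P => i j.
apply: injF; exists (fun _ => F i 1%g 1%g / F j 1%g 1%g)%R; rewrite G1.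
have f0 k : (F k 1%g 1%g != 0)%R by case: (cocF k) => f0 _; rewrite f0 ?group1.
split=> [x _ | x y /set1P-> /set1P->]; first by rewrite GRing.mulf_neq0 ?GRing.invr_eq0.
rewrite /= GRing.mulfK ?GRing.mulf_neq0 ?GRing.invr_eq0 ?f0 //.
by rewrite GRing.mulrC GRing.divfK ?f0.
Qed.

Lemma central_subgroup G H : p.-group G -> H <| G -> H :!=: 1 ->
  exists A : {group gT}, [/\ A \subset 'Z(G), A \subset H & #|A| = p].
Proof.
move=> pG nHG ntH; have := meet_center_nil (pgroup_nil pG) nHG ntH.
have pHZ : p.-group (H :&: 'Z(G)).
  by apply: pgroupS pG; apply: subset_trans (subsetIl _ _) (normal_sub nHG).
case/(pgroup_pdiv pHZ) => _ /(Cauchy pr_p)[x /setIP[Hx Zx] ox] _.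
by exists <[x]>%G; split; rewrite ?cycle_subG // -ox.
Qed.

Lemma card_quotient_der G A : A \subset 'Z(G) -> A \subset G^`(1) ->
  (#|(G / A)^`(1)| * #|A| = #|G^`(1)|)%N.
Proof.
move=> sAZ sAG'; have nAG := normal_norm (sub_center_normal sAZ).
rewrite -quotient_der // card_quotient ?(subset_trans (der_sub _ _)) //.
by rewrite mulnC Lagrange.
Qed.

Lemma card_quotient_mul G A : A \subset 'Z(G) -> (#|G / A| * #|A| = #|G|)%N.
Proof.
move=> sAZ; rewrite card_quotient ?(normal_norm (sub_center_normal sAZ)) //.
by rewrite mulnC Lagrange // (subset_trans sAZ) ?center_sub.
Qed.

Lemma central_der_step G A N m n : p.-group G ->
    A \subset 'Z(G) -> A \subset G^`(1) -> #|A| = p -> N \subset G ->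
    (forall f, cocycle2 G f ->
       forall x a, x \in N -> a \in A -> alt f x a = 1%R) ->
    multiplier_le (G / A) m -> (m * #|G : N| <= n * p)%N ->
  multiplier_le G n.
Proof.
move=> pG sAZ sAG' oA sNG altN leGA le_mn.
apply: multiplier_leW (central_step pr_p pG sAZ oA sNG altN leGA).
rewrite (setIidPl sAG') oA -(mulnK n (prime_gt0 pr_p)).
exact: leq_div2r.
Qed.

Lemma alt_der_central G f x a : cocycle2 G f ->
  x \in G^`(1) -> a \in 'Z(G) -> alt f x a = 1%R.
Proof.
move=> cocf G'x Za; have /centerP[Ga ca] := Za.
apply: (@hom_der1 _ G (fun y => alt f y a)) => // [y Gy | y z Gy Gz].
  by rewrite (alt_neq0 cocf).
by rewrite (altMl cocf) //; apply/commute_sym/ca.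
Qed.

(** The conjugates [x * [~ x, y]] of [x] all lie in one coset of [G']. *)
Lemma index_cent1_le G x : x \in G -> (#|G : 'C_G[x]| <= #|G^`(1)|)%N.
Proof.
move=> Gx; rewrite index_cent1 -(card_lcoset _ x); apply: subset_leq_card.
apply/subsetP=> _ /imsetP[y Gy ->].
by rewrite mem_lcoset -commgEl mem_commg.
Qed.

Lemma nonabelian_commg G : G^`(1) != 1 ->
  exists2 h, h \in G & exists2 k, k \in G & [~ h, k] != 1.
Proof.
move=> ntG'; have : ~~ (G \subset 'C(G)) by apply: contra ntG' => /derG1P/eqP.
case/subsetPn=> h Gh; rewrite -sub_cent1 => /subsetPn[k Gk chk].
exists h => //; exists k => //; apply: contra chk => /commgP chk.
exact/cent1P/commute_sym.
Qed.

Lemma index_setI_le G H N : H \subset G -> N \subset G ->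
  (#|G : H :&: N| <= #|G : H| * #|G : N|)%N.
Proof.
move=> sHG sNG; rewrite -(leq_pmul2l (cardG_gt0 (H :&: N))).
rewrite Lagrange ?subIset ?sHG // -(leq_pmul2l (cardG_gt0 G)).
have -> : (#|G| * (#|H :&: N| * (#|G : H| * #|G : N|)) =
   #|G| * #|H :&: N| * (#|G : H| * #|G : N|))%N by rewrite mulnA.
rewrite -{1}(Lagrange sHG) -{1}(Lagrange sNG) mulnACA leq_mul2r; apply/orP; right.
rewrite mul_cardG leq_mul2r; apply/orP; right; apply: subset_leq_card.
by rewrite mul_subG.
Qed.

End CentralSubgroups.

Section SmallOrders.
Import GroupScope.
Variable p : nat.
Hypothesis pr_p : prime p.

(** Induction with [N = A] of order p: the pairing vanishes on the cyclic group [A], and the index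
    p^n adds [n] to the exponent 'C(n, 2). *)
Lemma multiplier_abelian n (gT : finGroupType) (G : {group gT}) :
  abelian G -> #|G| = (p ^ n)%N -> multiplier_le G (p ^ 'C(n, 2)).
Proof.
elim: n gT G => [|n IHn] gT G abG oG.
  by apply: multiplier_le_trivial; apply/eqP; rewrite trivg_card1 oG.
have pG : p.-group G by rewrite /pgroup oG pnatX pnat_id.
have ntG : G :!=: 1 by rewrite -cardG_gt1 oG -(exp1n n.+1) ltn_exp2r ?prime_gt1.
have [A [sAZ sAG oA]] := central_subgroup pr_p pG (normal_refl G) ntG.
have oGA : #|G / A| = (p ^ n)%N.
  apply/eqP; rewrite -(eqn_pmul2r (prime_gt0 pr_p)) -{1}oA card_quotient_mul //.
  by rewrite oG expnSr.
have leGA := IHn _ _ (quotient_abelian A abG) oGA.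
have altA f : cocycle2 G f -> forall x a, x \in A -> a \in A -> alt f x a = 1%R.
  move=> cocf; have /cyclicP[b defA] : cyclic A by rewrite prime_cyclic ?oA.
  have Gb : b \in G by rewrite (subsetP sAG) // defA cycle_id.
  move=> x a; rewrite defA => /cycleP[i ->] /cycleP[j ->].
  rewrite (altXl cocf) ?groupX // ?(alt_powl cocf) ?GRing.expr1n //.
  exact: commuteX.
apply: multiplier_leW (central_step pr_p pG sAZ oA sAG altA leGA).
rewrite (derG1P abG) setIg1 cards1 divn1 binS bin1 expnD leq_mul2l; apply/orP; right.
rewrite -(leq_pmul2l (prime_gt0 pr_p)) -{1}oA Lagrange // oG expnS //.
Qed.

(** Induction on [G'] with [N = G'], which pairs trivially with central elements because characters
    kill [G']. Each step multiplies the bound by p^2 / p; the abelian group of order p^2 starts it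
    at p. *)
Lemma multiplier_der_index_p2 (gT : finGroupType) (G : {group gT}) :
  p.-group G -> #|G : G^`(1)| = (p ^ 2)%N -> multiplier_le G (p * #|G^`(1)|).
Proof.
have [n] := ubnP #|G^`(1)|; elim: n gT G => // n IHn gT G le_n pG iG.
have := Lagrange (der_sub 1 G); rewrite iG /= => oG.
have [G'1 | ntG'] := eqVneq G^`(1) 1.
  have abG : abelian G by apply/derG1P.
  rewrite G'1 cards1 mul1n in oG.
  by rewrite G'1 cards1 muln1; apply: (multiplier_abelian (n := 2)).
have [A [sAZ sAG' oA]] := central_subgroup pr_p pG (der_normal 1 G) ntG'.
have oQ' := card_quotient_der sAZ sAG'; have oQ := card_quotient_mul sAZ.
have iQ : #|G / A : (G / A)^`(1)| = (p ^ 2)%N.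
  apply/eqP; rewrite -(eqn_pmul2l (cardG_gt0 (G / A)^`(1))) Lagrange ?der_sub //.
  by rewrite -(eqn_pmul2r (prime_gt0 pr_p)) -{1 3}oA oQ mulnAC oQ' oG.
have leQ := IHn _ (G / A)%G _ (quotient_pgroup A pG) iQ.
apply: (central_der_step pr_p pG sAZ sAG' oA (der_sub 1 G) _ (leQ _)).
- by move=> f cocf x a G'x Aa; apply: (alt_der_central cocf G'x); apply: (subsetP sAZ).
- rewrite -ltnS (leq_trans _ le_n) // ltnS -oQ' oA ltn_Pmulr ?prime_gt1 //.
by rewrite iG -oQ' oA; rewrite -mulnn !mulnA.
Qed.

(** [G'] is generated by a single commutator [[~ h, k]], which pairs trivially with everything
    commuting with both [h] and [k]. That double centralizer has index at most p^2, and the abelian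
    quotient of order p^3 contributes p^3, giving p^3 * p^2 / p. *)
Lemma multiplier_p4 (gT : finGroupType) (G : {group gT}) :
  #|G| = (p ^ 4)%N -> #|G^`(1)| = p -> multiplier_le G (p ^ 4).
Proof.
move=> oG oG'; have pG : p.-group G by rewrite /pgroup oG pnatX pnat_id.
have ntG' : G^`(1) != 1 by rewrite -cardG_gt1 oG' prime_gt1.
have [A [sAZ sAG' oA]] := central_subgroup pr_p pG (der_normal 1 G) ntG'.
have defA : A :=: G^`(1) by apply/eqP; rewrite eqEcard sAG' oA oG' leqnn.
have [h Gh [k Gk nt_hk]] := nonabelian_commg ntG'.
have defC : <[[~ h, k]]> = G^`(1).
  have ohk : #[[~ h, k]] = p.
    by apply/(prime_nt_dvdP pr_p); rewrite ?order_eq1 // -oG' order_dvdG ?mem_commg.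
  by apply/eqP; rewrite eqEcard cycle_subG mem_commg //= oG' -orderE ohk leqnn.
pose N := 'C_G[h] :&: 'C_G[k].
have altN f : cocycle2 G f -> forall x a, x \in N -> a \in A -> alt f x a = 1%R.
  move=> cocf x a /setIP[/setIP[Gx /cent1P cxh] /setIP[_ /cent1P cxk]].
  have Ghk : [~ h, k] \in G by rewrite groupR.
  have /centerP[_ cG'] : [~ h, k] \in 'Z(G) by rewrite (subsetP sAZ) // defA mem_commg.
  rewrite defA -defC => /cycleP[i ->]; rewrite -altV (altXl cocf) //; last exact: cG'.
  by rewrite (alt_commg cocf) // GRing.expr1n GRing.invr1.
have sNG : N \subset G by rewrite !subIset ?subxx.
apply: (central_der_step pr_p pG sAZ sAG' oA sNG altN (m := p ^ 3)).
  apply: (multiplier_abelian (n := 3)); first by rewrite defA der_abelian.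
  apply/eqP; rewrite -(eqn_pmul2r (prime_gt0 pr_p)) -{1}oA card_quotient_mul //.
  by rewrite oG expnSr.
have leN : (#|G : N| <= p * p)%N.
  apply: leq_trans (index_setI_le _ _) _; rewrite ?subsetIl // -oG'.
  by rewrite leq_mul // index_cent1_le.
by rewrite (leq_trans (leq_mul (leqnn _) leN)) // -expnSr mulnn -expnD.
Qed.
End SmallOrders.

Section PGroups.
Import GroupScope.
Variables (gT : finGroupType) (p : nat).
Hypothesis pr_p : prime p.
Implicit Types G H A B N : {group gT}.

Lemma leq_p_proper A B x : p.-group B -> A \subset B -> x \in B -> x \notin A ->
  (#|A| * p <= #|B|)%N.
Proof.
move=> pB sAB Bx nAx; rewrite -(Lagrange sAB) leq_mul2l; apply/orP; right.
have pAB : p.-nat #|B : A| by apply: pnat_dvd (dvdn_indexg _ _) pB.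
have : (1 < #|B : A|)%N by rewrite indexg_gt1; apply/subsetPn; exists x.
have [[|e] ->] := p_natP pAB; first by [].
by move=> _; rewrite expnS leq_pmulr // expn_gt0 prime_gt0.
Qed.

Lemma expg_index_le G N x : p.-group G -> N <| G -> (#|G : N| <= p)%N -> x \in G ->
  x ^+ p \in N.
Proof.
move=> pG /andP[sNG nNG] leN Gx; have Nx := subsetP nNG x Gx.
have dvp : #|G / N| %| p.
  have pQ : p.-nat #|G : N| by apply: pnat_dvd (dvdn_indexg _ _) pG.
  rewrite card_quotient //; have [e E] := p_natP pQ; rewrite E in leN *.
  by move: leN; rewrite -{2}(expn1 p) leq_exp2l ?prime_gt1 // => /(dvdn_exp2l p); rewrite expn1.
apply: coset_idr; first exact: groupX.
rewrite morphX //; have /dvdnP[k ->] := dvp.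
by rewrite mulnC expgM expg_cardG ?expg1n ?mem_quotient.
Qed.

(** Each centralizer has index at most p, while [k] and then [h] witness that both inclusions below
    [G] are proper. *)
Lemma card_double_cent G h k : p.-group G -> #|G^`(1)| = p ->
    h \in G -> k \in G -> [~ h, k] != 1 ->
  (#|'C_G[h] :&: 'C_G[k]| * (p * p) = #|G|)%N.
Proof.
move=> pG oG' Gh Gk nt_hk; pose D := ('C_G[h] :&: 'C_G[k])%G.
have nkh : k \notin 'C_G[h].
  by apply: contra nt_hk => /setIP[_ /cent1P ckh]; apply/commgP/commute_sym.
have nhk : h \notin D.
  by apply: contra nt_hk => /setIP[_ /setIP[_ /cent1P ckh]]; apply/commgP.
have sChG : 'C_G[h] \subset G by apply: subsetIl.
have sDC : D \subset 'C_G[h] by apply: subsetIl.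
have Ch : h \in 'C_G[h] by rewrite in_setI Gh cent1id.
have le1 := leq_p_proper (pgroupS sChG pG) sDC Ch nhk.
have le2 := leq_p_proper pG sChG Gk nkh.
apply/eqP; rewrite eqn_leq; apply/andP; split.
  by rewrite mulnA; apply: leq_trans le2; rewrite leq_mul2r le1 orbT.
rewrite -(Lagrange (subset_trans sDC sChG)) leq_mul2l; apply/orP; right.
by rewrite (leq_trans (index_setI_le _ _)) ?subsetIl // leq_mul // -oG' index_cent1_le.
Qed.

(* For z in D = 'C_G[h] :&: 'C_G[k], 'C_G[z] properly contains its intersection
   with 'C_G[h] (witness k), which properly contains D (witness h). *)
Lemma der_p_central G h k : p.-group G -> #|G^`(1)| = p ->
    h \in G -> k \in G -> [~ h, k] != 1 ->
    abelian ('C_G[h] :&: 'C_G[k]) ->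
  'C_G[h] :&: 'C_G[k] \subset 'Z(G).
Proof.
move=> pG oG' Gh Gk nt_hk abD; apply/subsetP=> z Dz.
have /setIP[/setIP[Gz czh] /setIP[_ czk]] := Dz.
have nkh : k \notin 'C_G[h].
  by apply: contra nt_hk => /setIP[_ /cent1P ckh]; apply/commgP/commute_sym.
have nhk : h \notin 'C_G[k].
  by apply: contra nt_hk => /setIP[_ /cent1P ckh]; apply/commgP.
have sCz : 'C_G[z] \subset G by apply: subsetIl.
have le1 := @leq_p_proper ('C_G[h] :&: 'C_G[k]) ('C_G[z] :&: 'C_G[h]) h.
have le2 := @leq_p_proper ('C_G[z] :&: 'C_G[h]) 'C_G[z] k.
have iD : (#|G : 'C_G[h] :&: 'C_G[k]| <= p * p)%N.
  by rewrite (leq_trans (index_setI_le _ _)) ?subsetIl // leq_mul // -oG' index_cent1_le.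
have sDG : 'C_G[h] :&: 'C_G[k] \subset G.
  exact: subset_trans (subsetIl _ _) (subsetIl _ _).
have oD := Lagrange sDG.
suff eC : 'C_G[z] = G.
  by apply/centerP; split=> // y; rewrite -{1}eC => /setIP[_ /cent1P/commute_sym].
apply/eqP; rewrite eqEcard sCz -{1}oD.
apply: leq_trans (leq_mul (leqnn _) iD) _; rewrite mulnA.
apply: leq_trans (le2 _ _ _ _); rewrite ?subsetIl ?(pgroupS sCz) //.
- rewrite leq_mul2r; apply/orP; right; apply: le1.
  + by apply: pgroupS pG; apply: subset_trans (subsetIl _ _) sCz.
  + rewrite subsetI subsetIl andbT; apply/subsetP=> y Dy.
    have /setIP[/setIP[Gy _] _] := Dy; rewrite in_setI Gy.
    by apply/cent1P; apply: (centsP abD).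
  + by rewrite 2!in_setI Gh cent1C czh in_setI Gh cent1id.
  + by apply: contra nhk => /setIP[].
- by rewrite in_setI Gk cent1C.
- by apply: contra nkh => /setIP[].
Qed.

End PGroups.

(** * Groups of order p^5 with center of order p^2 *)

Section OrderP5.
Import GroupScope.
Variables (gT : finGroupType) (p : nat).
Hypothesis pr_p : prime p.
Variable G : {group gT}.
Implicit Types A N : {group gT}.
Hypothesis oG : #|G| = (p ^ 5)%N.
Hypothesis oZ : #|'Z(G)| = (p ^ 2)%N.

Let p_gt0 := prime_gt0 pr_p.
Let p_gt1 := prime_gt1 pr_p.

Let pG : p.-group G.
Proof. by rewrite /pgroup oG pnatX pnat_id. Qed.

Lemma p5_not_abelian : ~~ abelian G.
Proof.
apply/negP=> /center_idP/(congr1 (fun A : {set gT} => #|A|)).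
by rewrite oG oZ => /eqP; rewrite eqn_exp2l.
Qed.

(** The double centralizer [D] of a noncommuting pair would have order p^3 and contain ['Z(G)]
    centrally with index p, hence be abelian, hence central in [G], which is too large. *)
Lemma p5_der_neq_p : #|G^`(1)| <> p.
Proof.
move=> oG'; have ntG' : G^`(1) != 1 by rewrite -cardG_gt1 oG'.
have [h Gh [k Gk nt_hk]] := nonabelian_commg ntG'.
pose D := ('C_G[h] :&: 'C_G[k])%G.
have oD : #|D| = (p ^ 3)%N.
  have := card_double_cent pr_p pG oG' Gh Gk nt_hk; rewrite oG (expnD p 3 2) -mulnn.
  by move/eqP; rewrite eqn_pmul2r ?muln_gt0 ?p_gt0 // => /eqP.
have sZD : 'Z(G) \subset D.
  apply/subsetP=> z /centerP[Gz cz]; rewrite !in_setI Gz.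
  by apply/andP; split; apply/cent1P; apply: cz.
have sDG : D \subset G := subset_trans (subsetIl _ _) (subsetIl G _).
have sZZD : 'Z(G) \subset 'Z(D).
  by rewrite subsetI sZD (subset_trans (subsetIr _ _)) ?centS.
have abD : abelian D.
  apply: (cyclic_factor_abelian sZZD); apply: (dvdn_prime_cyclic pr_p).
  have := card_quotient_mul sZZD; rewrite oZ oD (expnS p 2) => /eqP.
  by rewrite eqn_pmul2r ?expn_gt0 ?p_gt0 // => /eqP ->.
have := subset_leq_card (der_p_central pr_p pG oG' Gh Gk nt_hk abD).
by rewrite -/D oZ oD leq_exp2l.
Qed.

(** If |G'| were p^4 or more, [G / G'] would have order dividing p and be cyclic, forcing the
    nilpotent group [G] to be abelian. *)
Lemma p5_card_der : #|G^`(1)| = (p ^ 2)%N \/ #|G^`(1)| = (p ^ 3)%N.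
Proof.
have [e oG'] : exists e, #|G^`(1)| = (p ^ e)%N.
  by exists (logn p #|G^`(1)|); apply: card_pgroup (pgroupS (der_sub 1 G) pG).
have ncyc : ~~ cyclic (G / G^`(1)).
  apply: contra p5_not_abelian => /(cyclic_nilpotent_quo_der1_cyclic (pgroup_nil pG)).
  exact: cyclic_abelian.
have oQ : (p ^ e * #|G / G^`(1)| = p ^ 5)%N.
  by rewrite card_quotient ?der_norm // -oG' Lagrange ?der_sub.
case: e => [|[|[|[|e]]]] in oG' oQ *; [| | by left | by right |].
- by case/negP: p5_not_abelian; apply/derG1P/eqP; rewrite trivg_card1 oG'.
- by case: p5_der_neq_p; rewrite oG' expn1.
case/negP: ncyc; apply: (dvdn_prime_cyclic pr_p).
rewrite -(dvdn_pmul2l (p := p ^ e.+4)) ?expn_gt0 ?p_gt0 // oQ -expnSr.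
by apply: dvdn_exp2l.
Qed.

Lemma multiplier_p5_der_p3 : #|G^`(1)| = (p ^ 3)%N -> multiplier_le G (p ^ 4).
Proof.
move=> oG'; rewrite expnS -oG'; apply: (multiplier_der_index_p2 pr_p pG).
apply/eqP; rewrite -(eqn_pmul2l (cardG_gt0 G^`(1))) Lagrange ?der_sub //.
by rewrite oG oG' -expnD.
Qed.

Section DerP2.
Hypothesis oG' : #|G^`(1)| = (p ^ 2)%N.

(** [multiplier_p4] applies to [G / A]; the index of [N], at most p, is absorbed by the factor p
    saved because [A] lies in [G']. *)
Lemma p5_step A N : A \subset 'Z(G) -> A \subset G^`(1) -> #|A| = p ->
    N \subset G -> (p ^ 4 <= #|N|)%N ->
    (forall f, cocycle2 G f ->
       forall x a, x \in N -> a \in A -> alt f x a = 1%R) ->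
  multiplier_le G (p ^ 4).
Proof.
move=> sAZ sAG' oA sNG leN altN.
apply: (central_der_step pr_p pG sAZ sAG' oA sNG altN (m := p ^ 4)).
  apply: (multiplier_p4 pr_p).
    apply/eqP; rewrite -(eqn_pmul2r p_gt0) -{1}oA card_quotient_mul //.
    by rewrite oG -expnSr.
  apply/eqP; rewrite -(eqn_pmul2r p_gt0) -{1}oA card_quotient_der //.
  by rewrite oG' mulnn.
rewrite leq_mul2l; apply/orP; right.
have : (p ^ 4 * #|G : N| <= p ^ 4 * p)%N; last by rewrite leq_pmul2l ?expn_gt0 ?p_gt0.
by rewrite -expnSr -oG -(Lagrange sNG) leq_mul2r leN orbT.
Qed.


Lemma multiplier_p5_class3 : ~~ (G^`(1) \subset 'Z(G)) -> multiplier_le G (p ^ 4).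
Proof.
move=> nsG'Z; pose A := [~: G^`(1), G]%G.
have sG'G : G^`(1) \subset G := der_sub 1 G.
have ntG' : G^`(1) != 1 by apply: contraNneq nsG'Z => ->; apply: sub1G.
have sAG' : A \subset G^`(1) by rewrite commg_subl der_norm.
have sAG := subset_trans sAG' sG'G.
have ntA : A :!=: 1.
  apply: contra nsG'Z => /eqP/commG1P sG'C.
  by rewrite subsetI sG'G.
have prA : A \proper G^`(1).
  by apply: (nil_comm_properl (pgroup_nil pG)) => //; rewrite subsetI subxx der_norm.
have oA : #|A| = p.
  have pA := pgroupS sAG pG; have [_ _ [e oAe]] := pgroup_pdiv pA ntA.
  have := proper_card prA; rewrite oG' oAe ltn_exp2l // ltnS.
  by case: e oAe => // -> _; rewrite expn1.
have nAG : A <| G by rewrite /normal sAG commg_normr.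
have sAZ : A \subset 'Z(G).
  have [A0 [sA0Z sA0A oA0]] := central_subgroup pr_p pG nAG ntA.
  by have /eqP <- : A0 :==: A by rewrite eqEcard sA0A oA0 oA leqnn.
have AG'G v x : v \in G^`(1) -> x \in G -> [~ v, x] \in A.
  by move=> G'v Gx; rewrite mem_commg.
have [u G'u nAu] : exists2 u, u \in G^`(1) & u \notin 'Z(G) by apply/subsetPn.
have Gu := subsetP sG'G u G'u; pose C := 'C_G[u]%G.
have sCG : C \subset G by apply: subsetIl.
have [x Gx nCx] : exists2 x, x \in G & x \notin C.
  apply/subsetPn; apply: contra nAu => sGC; apply/centerP; split=> // y Gy.
  by have /setIP[_ /cent1P/commute_sym] := subsetP sGC y Gy.
have iC : (#|G : C| <= p)%N.
  rewrite index_cent1 -oA -(card_lcoset A u); apply: subset_leq_card.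
  by apply/subsetP=> _ /imsetP[y Gy ->]; rewrite mem_lcoset -commgEl AG'G.
have leC : (p ^ 4 <= #|C|)%N.
  have : (p ^ 4 * p <= #|C| * p)%N; last by rewrite leq_pmul2r.
  by rewrite -expnSr -oG -(Lagrange sCG) leq_mul2l iC orbT.
have maxC (B : {group gT}) z : B \subset G -> C \subset B -> z \in B ->
    z \notin C -> B :=: G.
  move=> sBG sCB Bz nCz; apply/eqP; rewrite eqEcard sBG oG expnSr.
  apply: leq_trans (leq_p_proper pr_p (pgroupS sBG pG) sCB Bz nCz).
  by rewrite leq_mul2r leC orbT.
(* The centralizer of [y] in [G'] contains [A] and also [u] outside [A], so it has order p^2: thus
   [C] centralizes all of [G']. *)
have centG' y v : y \in C -> v \in G^`(1) -> commute y v.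
  move=> /setIP[Gy /cent1P cyu] G'v.
  have sKG' : 'C_(G^`(1))[y] \subset G^`(1) by apply: subsetIl.
  have sAK : A \subset 'C_(G^`(1))[y].
    rewrite subsetI sAG'; apply/subsetP=> a /(subsetP sAZ)/centerP[_ ca].
    exact/cent1P/ca.
  have Ku : u \in 'C_(G^`(1))[y] by rewrite in_setI G'u; apply/cent1P.
  have nAu' : u \notin A by apply: contra nAu; apply: (subsetP sAZ).
  have := leq_p_proper pr_p (pgroupS (subset_trans sKG' sG'G) pG) sAK Ku nAu'.
  rewrite oA mulnn -oG' => leK.
  have /eqP eK : 'C_(G^`(1))[y] == G^`(1) by rewrite eqEcard sKG'.
  by move: G'v; rewrite -{1}eK => /setIP[_ /cent1P/commute_sym].
have sZC : 'Z(G) \subset C.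
  apply/subsetP=> z /centerP[Gz cz]; rewrite in_setI Gz.
  exact/cent1P/cz.
have nZG : G \subset 'N('Z(G)) := normal_norm (center_normal G).
(* Otherwise each [[~ y, x]] with [y] in [C] commutes with [C] and with [x], so it is central. Then
   [C / 'Z(G)] is central in [G / 'Z(G)] with cyclic quotient, and [G / 'Z(G)] is abelian, against
   the hypothesis. *)
have [y0 Cy0 nt0] : exists2 y, y \in C & [~ [~ y, x], x] != 1.
  have [/existsP[y /andP[Cy nty]] | none] := boolP [exists y, (y \in C) && ([~ [~ y, x], x] != 1)].
    by exists y.
  case/negP: nsG'Z.
  have cyx y : y \in C -> [~ y, x] \in 'Z(G).
    move=> Cy; have Gy := subsetP sCG y Cy.
    have G'yx : [~ y, x] \in G^`(1) by rewrite mem_commg.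
    have Gyx := subsetP sG'G _ G'yx.
    have eC : 'C_G[[~ y, x]] = G.
      apply: (maxC _ x); rewrite ?subsetIl //.
        apply/subsetP=> c Cc; rewrite in_setI (subsetP sCG) //.
        by apply/cent1P; apply: centG'.
      rewrite in_setI Gx; apply/cent1P/commute_sym/commgP.
      by apply: contraNT none => nt; apply/existsP; exists y; rewrite Cy.
    by apply/centerP; split=> // g; rewrite -{1}eC => /setIP[_ /cent1P/commute_sym].
  have oC : #|C| = (p ^ 4)%N.
    apply/eqP; rewrite eqn_leq leC andbT -(leq_pmul2r p_gt0) -expnSr -oG.
    exact: (leq_p_proper pr_p pG sCG Gx nCx).
  have nZC := subset_trans sCG nZG.
  have abQ : abelian (C / 'Z(G)).
    apply: (card_p2group_abelian pr_p); rewrite card_quotient //.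
    apply/eqP; rewrite -(eqn_pmul2l (cardG_gt0 'Z(G))) Lagrange // oC oZ.
    by rewrite -expnD.
  have sQ : C / 'Z(G) \subset G / 'Z(G) by apply: quotientS.
  have nQx : coset 'Z(G) x \notin C / 'Z(G).
    apply: contra nCx => /morphimP[c Nc Cc /eqP].
    rewrite eq_sym => /eqP/(rcoset_kercosetP Nc (subsetP nZG x Gx))/rcosetP[z Zz Ec].
    by rewrite -(groupMl _ (subsetP sZC z Zz)) -Ec.
  have pQ : p.-group (G / 'Z(G)) := quotient_pgroup _ pG.
  have oQ : #|G / 'Z(G)| = (#|C / 'Z(G)| * p)%N.
    rewrite !card_quotient //; apply/eqP; rewrite -(eqn_pmul2l (cardG_gt0 'Z(G))).
    by rewrite mulnA !Lagrange ?center_sub // oC oG expnSr.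
  have cQ : C / 'Z(G) \subset 'Z(G / 'Z(G)).
    apply/subsetP=> Y QY; apply/centerP; split; first exact: (subsetP sQ).
    have eC : 'C_(G / 'Z(G))[Y] = G / 'Z(G).
      apply/eqP; rewrite eqEcard subsetIl oQ.
      apply: (@leq_p_proper _ p pr_p _ _ (coset 'Z(G) x)) => //.
      - by apply: pgroupS pQ; apply: subsetIl.
      - rewrite subsetI sQ; apply/subsetP=> X QX; apply/cent1P.
        exact: (centsP abQ).
      have /morphimP[y Ny Cy ->] := QY.
      rewrite in_setI mem_quotient //; apply/cent1P/commute_sym/commgP.
      rewrite -morphR ?(subsetP nZG x Gx) //.
      by apply/eqP/coset_id/cyx.
    by move=> X; rewrite -{1}eC => /setIP[_ /cent1P/commute_sym].
  have cycQ : cyclic ((G / 'Z(G)) / (C / 'Z(G))).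
    rewrite prime_cyclic // card_quotient; last first.
      by apply: (subset_trans _ (cent_sub _)); rewrite centsC (subset_trans cQ) ?subsetIr.
    by rewrite -divgS // oQ mulKn ?cardG_gt0.
  by apply: der1_min => //; apply: (cyclic_factor_abelian cQ).
have key f y b : cocycle2 G f -> y \in C -> [~ [~ y, x], x] != 1 -> b \in A ->
    alt f y b = 1%R.
  move=> cocf Cy ntb Ab; set v := [~ y, x] in ntb *; set c := [~ v, x] in ntb *.
  have Gy := subsetP sCG y Cy.
  have G'v : v \in G^`(1) by rewrite mem_commg.
  have Gv := subsetP sG'G v G'v; have Ac : c \in A by apply: AG'G.
  have Gc := subsetP sAG c Ac; have /centerP[_ cc] := subsetP sAZ c Ac.
  have cyv := centG' y v Cy G'v.
  have cyc := commute_sym (cc y Gy); have cvc := commute_sym (cc v Gv).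
  have yx : y ^ x = y * v by rewrite conjg_mulR.
  have vx : v ^ x = v * c by rewrite conjg_mulR.
  (* Conjugation by [x] sends the commuting pair [y], [v] to [y * v], [v * c]. After expansion
     [alt f v v] and [alt f v c] are 1, so invariance leaves [alt f y c = 1]. *)
  clearbody v c; have E : alt f y c = 1%R.
    have := alt_conj cocf Gy Gv Gx cyv; rewrite yx vx.
    have cyvv : commute (y * v) v by apply/commute_sym/commuteM; first exact: commute_sym.
    have cyvc : commute (y * v) c by apply/commute_sym/commuteM; apply: cc.
    rewrite (altMr cocf) ?(groupM Gy Gv) // !(altMl cocf) // (altxx cocf) // GRing.mulr1.
    rewrite (alt_der_central cocf G'v (subsetP sAZ c Ac)) GRing.mulr1.
    rewrite -[RHS]GRing.mulr1 => /(GRing.mulfI (alt_neq0 cocf Gy Gv)) //.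
  have [i ->] : exists i, b = c ^+ i.
    have oc : #[c] = p.
      by apply/(prime_nt_dvdP pr_p); rewrite ?order_eq1 // -oA order_dvdG.
    have /eqP eA : <[c]> == A by rewrite eqEcard cycle_subG Ac oA -orderE oc leqnn.
    by move: Ab; rewrite -{1}eA => /cycleP.
  by rewrite -altV (altXl cocf) // -altV E GRing.invr1 GRing.expr1n GRing.invr1.
apply: (p5_step sAZ sAG' oA sCG leC) => f cocf y b Cy Ab.
(* If [[~ y, x]] commutes with [x], then [key] applies to [y * y0] and to [y0], and dividing settles
   [y]. *)
have [cy1 | /key] := eqVneq [~ [~ y, x], x] 1; last by apply.
have Gy := subsetP sCG y Cy; have Gy0 := subsetP sCG y0 Cy0.
have Gb := subsetP sAG b Ab; have /centerP[_ cb] := subsetP sAZ b Ab.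
have G'y : [~ y, x] \in G^`(1) by rewrite mem_commg.
have G'y0 : [~ y0, x] \in G^`(1) by rewrite mem_commg.
have nt : [~ [~ y * y0, x], x] != 1.
  rewrite (commMgJ y y0 x) (conjgE [~ y, x] y0) -(centG' _ _ Cy0 G'y) mulKg.
  by rewrite commMgJ cy1 conj1g mul1g.
have := key f (y * y0) b cocf (groupM Cy Cy0) nt Ab.
rewrite (altMl cocf) //; try by apply/commute_sym/cb.
by rewrite (key f y0 b cocf Cy0 nt0 Ab) GRing.mulr1.
Qed.

End DerP2.
End OrderP5.

(** * Groups with derived subgroup equal to the center *)

Section Special.
Import GroupScope.
Variables (gT : finGroupType) (p : nat) (G : {group gT}).
Hypothesis pr_p : prime p.
Hypothesis oG : #|G| = (p ^ 5)%N.
Hypothesis oZ : #|'Z(G)| = (p ^ 2)%N.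
Hypothesis defG' : G^`(1) = 'Z(G).

Let p_gt0 := prime_gt0 pr_p.
Let p_gt1 := prime_gt1 pr_p.

Let pG : p.-group G.
Proof. by rewrite /pgroup oG pnatX pnat_id. Qed.

Let cZ z x : z \in 'Z(G) -> x \in G -> commute x z.
Proof. by move=> /centerP[_ cz] Gx; apply/commute_sym/cz. Qed.

Let Zcomm x y : x \in G -> y \in G -> [~ x, y] \in 'Z(G).
Proof. by move=> Gx Gy; rewrite -defG' mem_commg. Qed.

(* Otherwise y ^+ p is not central, so that 'C_G[y] / 'Z(G) has order at least
   p ^ 2, 'C_G[y] has index at most p, and x ^+ p commutes with y. *)
Lemma special_commX x y : x \in G -> y \in G -> [~ x, y] ^+ p = 1.
Proof.
move=> Gx Gy; have Zxy := Zcomm Gx Gy.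
have sCG : 'C_G[y] \subset G by apply: subsetIl.
have sZC : 'Z(G) \subset 'C_G[y].
  apply/subsetP=> z Zz; rewrite in_setI (subsetP (center_sub G)) //.
  exact/cent1P/commute_sym/cZ.
have nZC : 'Z(G) <| 'C_G[y].
  exact: normalS sZC sCG (center_normal G).
have nCG : 'C_G[y] <| G by apply: sub_der1_normal; rewrite ?defG'.
have [leC | ltC] := leqP #|'C_G[y] : 'Z(G)| p.
  have Cy : y \in 'C_G[y] by rewrite in_setI Gy cent1id.
  have Zyp := expg_index_le pr_p (pgroupS sCG pG) nZC leC Cy.
  rewrite -(commgX _ (cZ Zxy Gy)); apply/eqP/commgP.
  exact: cZ.
have pI : p.-nat #|'C_G[y] : 'Z(G)|.
  exact: pnat_dvd (dvdn_indexg _ _) (pgroupS sCG pG).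
have [e oI] := p_natP pI; rewrite oI in ltC.
have e2 : (2 <= e)%N by rewrite -(ltn_exp2l _ _ p_gt1) expn1.
have leC : (p ^ 4 <= #|'C_G[y]|)%N.
  by rewrite -(Lagrange sZC) oI oZ (expnD p 2 2) leq_mul2l leq_exp2l // e2 orbT.
have iC : (#|G : 'C_G[y]| <= p)%N.
  have : (p ^ 4 * #|G : 'C_G[y]| <= p ^ 4 * p)%N; last first.
    by rewrite leq_pmul2l ?expn_gt0 ?p_gt0.
  by rewrite -expnSr -oG -(Lagrange sCG) leq_mul2r leC orbT.
have /setIP[_ /cent1P cxy] := expg_index_le pr_p pG nCG iC Gx.
by rewrite -(commXg _ (cZ Zxy Gx)); apply/eqP/commgP.
Qed.

Lemma special_expZ x : x \in G -> x ^+ p \in 'Z(G).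
Proof.
move=> Gx; apply/centerP; split=> [|y Gy]; first exact: groupX.
by apply/commgP; rewrite (commXg _ (cZ (Zcomm Gx Gy) Gx)) special_commX.
Qed.

Lemma special_centX z : z \in 'Z(G) -> z ^+ p = 1.
Proof.
have abZ : abelian 'Z(G) := center_abelian G.
have sK : G^`(1) \subset Group (group_Ldiv p abZ).
  rewrite gen_subG; apply/subsetP=> _ /imset2P[x y Gx Gy ->].
  by apply/LdivP; rewrite Zcomm // special_commX.
by rewrite -defG' => /(subsetP sK)/LdivP[].
Qed.

(** The correction term is [[~ y, x] ^+ 'C(p, 2)], and an odd prime p divides this binomial. *)
Lemma special_expM x y : odd p -> x \in G -> y \in G ->
  (x * y) ^+ p = x ^+ p * y ^+ p.
Proof.
move=> odd_p Gx Gy; have Zyx := Zcomm Gy Gx.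
rewrite (expMg_Rmul p (cZ Zyx Gy) (cZ Zyx Gx)).
have p2 : (2 < p)%N by rewrite odd_prime_gt2.
have /dvdnP[k ->] := prime_dvd_bin pr_p (p2 : 0 < 2 < p).
by rewrite mulnC expgM special_commX // expg1n mulg1.
Qed.

(** The p-th power map is a homomorphism into ['Z(G)], so its kernel [P] has index at most p^2;
    adjoining [x], which lies outside [P], raises the order to at least p^4. *)
Lemma multiplier_special x : odd p -> x \in G -> x ^+ p != 1 ->
  multiplier_le G (p ^ 4).
Proof.
move=> odd_p Gx ntw; set w := x ^+ p in ntw.
have Zw : w \in 'Z(G) by apply: special_expZ.
have Gw : w \in G by apply: groupX.
have oA : #|<[w]>| = p.
  by apply/(prime_nt_dvdP pr_p); rewrite ?order_eq1 // -orderE order_dvdn special_centX.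
have pwM : {in G &, {morph (fun y => y ^+ p) : y z / y * z}}.
  by move=> y z Gy Gz; apply: special_expM.
pose P := 'ker (Morphism pwM).
have sPG : P \subset G by apply: subsetIl.
have Pp z : z \in P -> z ^+ p = 1 by move/mker.
have iP : (#|G : P| <= p ^ 2)%N.
  rewrite -{1}(setIid G) -(card_morphim (Morphism pwM)) -oZ.
  apply: subset_leq_card; apply/subsetP=> _ /morphimP[y _ Gy ->].
  exact: special_expZ.
have leP : (p ^ 3 <= #|P|)%N.
  have : (p ^ 3 * p ^ 2 <= #|P| * p ^ 2)%N; last by rewrite leq_pmul2r ?expn_gt0 ?p_gt0.
  by rewrite -expnD -oG -(Lagrange sPG) leq_mul2l iP orbT.
pose N := <<x |: P>>%G.
have sNG : N \subset G by rewrite gen_subG subUset sub1set Gx.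
have sPN : P \subset N by rewrite (subset_trans (subsetUr [set x] P)) ?subset_gen.
have Nx : x \in N by rewrite mem_gen ?setU11.
have nPx : x \notin P by apply: contra ntw => /Pp/eqP.
have leN : (p ^ 4 <= #|N|)%N.
  apply: leq_trans (leq_p_proper pr_p (pgroupS sNG pG) sPN Nx nPx).
  by rewrite expnSr leq_mul2r leP orbT.
have oG' : #|G^`(1)| = (p ^ 2)%N by rewrite defG'.
apply: (p5_step pr_p oG oG' (A := <[w]>) _ _ oA sNG leN); rewrite ?defG' ?cycle_subG //.
move=> f cocf y a Ny /cycleP[i ->].
have altxw : alt f x w = 1%R := alt_powl cocf p Gx.
have ker0 z : z \in G -> alt f z w != 0%R by move=> Gz; apply: (alt_neq0 cocf).
have kerM u v : u \in G -> v \in G ->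
    alt f (u * v) w = (alt f u w * alt f v w)%R.
  by move=> Gu Gv; rewrite (altMl cocf) //; apply: cZ.
have sNK : N \subset Group (hom_ker_group_set ker0 kerM).
  rewrite gen_subG; apply/subsetP=> z /setU1P[-> | Pz].
    by rewrite inE Gx altxw eqxx.
  have Gz := subsetP sPG z Pz; rewrite inE Gz /=.
  (* For [z] in [P], [x * z] has the same p-th power [w] as [x], and every element pairs trivially
     with its own powers. *)
  have := alt_powl cocf p (groupM Gx Gz).
  by rewrite special_expM // (Pp z Pz) mulg1 -/w kerM // altxw GRing.mul1r => ->.
have Gy := subsetP sNG y Ny.
move/(subsetP sNK): Ny; rewrite inE => /andP[_ /eqP altyw].
rewrite -altV (altXl cocf) //; last exact/commute_sym/cZ.
by rewrite -altV altyw GRing.invr1 GRing.expr1n GRing.invr1.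
Qed.

End Special.

(** * Special groups of exponent p *)

Section Coordinates.
Import GRing.Theory.
Local Open Scope ring_scope.

Definition coords (K : Type) := (K * K * K * K * K)%type.

(* (a, b, c, m, n) stands for w2 ^ m * w3 ^ n * t ^ b * z ^ c * x ^ a with
   t, z commuting and w2 = [~ x, t], w3 = [~ x, z] central. *)
Definition cmul (K : comNzRingType) (u v : coords K) : coords K :=
  let: (a, b, c, m, n) := u in let: (a', b', c', m', n') := v in
  (a + a', b + b', c + c', m + m' + a * b', n + n' + a * c').

(** Each parameter prescribes commutators of lifts: [t1] for [t] with [z]; [t2], [t3] for [x] with
    [w2], [w3]; [t4] for [w2] with [t]; [t6] for [w3] with [z]. Only [t5] governs two pairs, [w2]
    with [z] and [w3] with [t], which the Hall-Witt identity forces to agree since [t] and [z]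
    commute. The terms in [t2], [t3], [t4], [t6] are doubled to avoid halves. *)
Definition cform (K : comNzRingType) (t : K * K * K * K * K * K) (u v : coords K) : K :=
  let: (a, b, c, m, n) := u in let: (a', b', c', m', n') := v in
  let: (t1, t2, t3, t4, t5, t6) := t in
  t1 * (b * c') + t2 * (2 * a * m' + a * a * b') + t3 * (2 * a * n' + a * a * c')
  + t4 * (2 * m * b' + a * b' * b') + t5 * (m * c' + n * b' + a * b' * c')
  + t6 * (2 * n * c' + a * c' * c').

Lemma cform_cocycle (K : comNzRingType) t (u v w : coords K) :
  cform t u v + cform t (cmul u v) w = cform t v w + cform t u (cmul v w).
Proof.
move: t u v w => [[[[[t1 t2] t3] t4] t5] t6] [[[[a b] c] m] n].
move=> [[[[a' b'] c'] m'] n'] [[[[a'' b''] c''] m''] n''].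
by rewrite /cform /cmul; ring.
Qed.

(** Six commuting pairs of basis elements each isolate one parameter, up to the factor 2. *)
Lemma cform_inj (K : fieldType) (s t : K * K * K * K * K * K) : 2 != 0 :> K ->
  (forall u v : coords K, cmul u v = cmul v u ->
     cform s u v + cform t v u = cform t u v + cform s v u) -> s = t.
Proof.
move: s t => [[[[[s1 s2] s3] s4] s5] s6] [[[[[t1 t2] t3] t4] t5] t6] two E.
have c2 := mulIf two.
have e1 := E (0, 1, 0, 0, 0) (0, 0, 1, 0, 0).
have e2 := E (1, 0, 0, 0, 0) (0, 0, 0, 1, 0).
have e3 := E (1, 0, 0, 0, 0) (0, 0, 0, 0, 1).
have e4 := E (0, 0, 0, 1, 0) (0, 1, 0, 0, 0).
have e5 := E (0, 0, 0, 1, 0) (0, 0, 1, 0, 0).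
have e6 := E (0, 0, 0, 0, 1) (0, 0, 1, 0, 0).
move: e1 e2 e3 e4 e5 e6; rewrite /cmul /cform !(mulr0, mul0r, mulr1, mul1r, addr0, add0r).
by do 6![move=> /(_ erefl) ?]; do !congr (_, _) => //; apply: c2.
Qed.

Section Cocycles.
Variables (gT : finGroupType) (G : {group gT}) (p : nat).
Hypotheses (pr_p : prime p) (odd_p : odd p).
Variable phi : coords 'F_p -> gT.
Hypothesis phi_inj : injective phi.
Hypothesis phi_onto : forall g, g \in G -> exists v, g = phi v.
Hypothesis phi_in : forall v, phi v \in G.
Hypothesis phiM : forall u v, (phi u * phi v)%g = phi (cmul u v).

Lemma coords_multiplier_ge n : multiplier_le G n -> (p ^ 6 <= n)%N.
Proof.
have [z prz] := C_prim_root_exists (prime_gt0 pr_p).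
(* A faithful additive character of F_p turns additive cocycles into multiplicative ones. *)
pose eps (a : 'F_p) : algC := z ^+ a.
have epsD a b : eps (a + b) = eps a * eps b.
  rewrite /eps -exprD; apply/eqP; rewrite (eq_prim_root_expr prz).
  by rewrite -{1}(natr_Zp a) -{1}(natr_Zp b) -natrD val_Fp_nat // modn_mod.
have eps_inj : injective eps.
  move=> a b /eqP; rewrite (eq_prim_root_expr prz) => /eqP e.
  by rewrite -(natr_Zp a) -(natr_Zp b); apply: val_inj; rewrite /= !val_Fp_nat.
have eps0 a : eps a != 0.
  have e1 : eps 0 = 1 by rewrite /eps expr0.
  apply/eqP=> ea; have := epsD a (- a); rewrite subrr e1 ea mul0r => /eqP.
  by rewrite oner_eq0.
pose psi g := odflt 0 [pick v | phi v == g].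
have psiK v : psi (phi v) = v.
  by rewrite /psi; case: pickP => [u /eqP/phi_inj // | /(_ v)]; rewrite eqxx.
pose F t g h := eps (cform t (psi g) (psi h)).
move/(_ _ F); rewrite !card_prod card_Fp // => le_n.
rewrite !expnS expn0 muln1 !mulnA; apply: le_n => [t | s t cst].
  split=> [g h _ _ | g h k /phi_onto[u ->] /phi_onto[v ->] /phi_onto[w ->]].
    exact: eps0.
  by rewrite /F !phiM !psiK -!epsD cform_cocycle.
apply: cform_inj => [|u v cuv].
  rewrite -(dvdn_pcharf (pchar_Fp pr_p)) dvdn_prime2 //.
  by apply: contraTneq odd_p => ->.
have cphi : commute (phi u) (phi v) by rewrite /commute !phiM cuv.
have := cohomologous_alt cst (phi_in u) (phi_in v) cphi.
rewrite /alt /F !psiK => e; apply: eps_inj; rewrite !epsD.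
set x1 := eps _ in e *; set x2 := eps _ in e *.
by apply/eqP; rewrite -eqr_div ?eps0 // e.
Qed.

End Cocycles.
End Coordinates.

Section ExponentP.
Import GroupScope.
Variables (gT : finGroupType) (p : nat) (G : {group gT}).
Hypothesis pr_p : prime p.
Hypothesis oG : #|G| = (p ^ 5)%N.
Hypothesis oZ : #|'Z(G)| = (p ^ 2)%N.
Hypothesis defG' : G^`(1) = 'Z(G).
Hypothesis expG : forall x, x \in G -> x ^+ p = 1.

Let p_gt0 := prime_gt0 pr_p.
Let p_gt1 := prime_gt1 pr_p.

Let pG : p.-group G.
Proof. by rewrite /pgroup oG pnatX pnat_id. Qed.

Let cZ z x : z \in 'Z(G) -> x \in G -> commute x z.
Proof. by move=> /centerP[_ cz] Gx; apply/commute_sym/cz. Qed.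

(* Modulo a central subgroup A of order p, the derived subgroup has order p,
   so the center is larger than 'Z(G) / A. *)
Lemma special_small_class : exists2 t, t \in G :\: 'Z(G) & (p ^ 4 <= #|'C_G[t]|)%N.
Proof.
have ntZ : 'Z(G) != 1 by rewrite -cardG_gt1 oZ -(expn0 p) ltn_exp2l.
have [A [sAZ _ oA]] := central_subgroup pr_p pG (center_normal G) ntZ.
have nAG := normal_norm (sub_center_normal sAZ).
have oQ : #|G / A| = (p ^ 4)%N.
  apply/eqP; rewrite -(eqn_pmul2r p_gt0) -{1}oA card_quotient_mul //.
  by rewrite oG -expnSr.
have oQ' : #|(G / A)^`(1)| = p.
  apply/eqP; rewrite -(eqn_pmul2r p_gt0) -{1}oA card_quotient_der ?defG' //.
  by rewrite oZ mulnn.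
have pQ : p.-group (G / A) := quotient_pgroup A pG.
have ntQ' : (G / A)^`(1) != 1 by rewrite -cardG_gt1 oQ'.
have [h Gh [k Gk nt_hk]] := nonabelian_commg ntQ'.
have oD := card_double_cent pr_p pQ oQ' Gh Gk nt_hk.
have {}oD : #|'C_(G / A)[h] :&: 'C_(G / A)[k]| = (p ^ 2)%N.
  move/eqP: oD; rewrite oQ (expnD p 2 2) -{2}mulnn.
  by rewrite eqn_pmul2r ?muln_gt0 ?p_gt0 // => /eqP.
have abD := card_p2group_abelian pr_p oD.
have sDZ := der_p_central pr_p pQ oQ' Gh Gk nt_hk abD.
have /subsetPn[T DT nZT] : ~~ ('C_(G / A)[h] :&: 'C_(G / A)[k] \subset 'Z(G) / A).
  apply/negP=> /subset_leq_card; rewrite oD => le.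
  have : (#|'Z(G) / A| * p < p ^ 2 * p)%N.
    rewrite -{1}oA card_quotient ?(subset_trans (center_sub G)) // mulnC Lagrange // oZ.
    by rewrite -expnSr ltn_exp2l.
  by rewrite ltn_pmul2r // ltnNge le.
have /centerP[/morphimP[t Nt Gt defT] cT] := subsetP sDZ T DT.
exists t.
  rewrite inE Gt andbT; apply: contra nZT => Zt.
  by rewrite defT mem_quotient.
(* [T] is central in [G / A], so the conjugates of its preimage [t] lie in one coset of [A] and
   number at most p. *)
have tA g : g \in G -> [~ t, g] \in A.
  move=> Gg; apply: coset_idr; first by rewrite (subsetP nAG) ?groupR.
  rewrite morphR ?(subsetP nAG) //; apply/eqP/commgP; rewrite -defT.
  by apply: cT; rewrite mem_quotient.
have iC : (#|G : 'C_G[t]| <= p)%N.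
  rewrite index_cent1 -oA -(card_lcoset A t); apply: subset_leq_card.
  by apply/subsetP=> _ /imsetP[y Gy ->]; rewrite mem_lcoset -commgEl tA.
have : (p ^ 4 * #|G : 'C_G[t]| <= #|'C_G[t]| * #|G : 'C_G[t]|)%N.
  by rewrite Lagrange ?subsetIl // oG (expnSr p 4) leq_mul2l iC orbT.
by rewrite leq_pmul2r.
Qed.

Lemma special_generators : exists x t z,
  [/\ x \in G, t \in G, z \in G, commute t z & <<[set x; t; z]>> = G].
Proof.
have [t /setDP[Gt nZt] leC] := special_small_class.
have sCG : 'C_G[t] \subset G by apply: subsetIl.
have Ct : t \in 'C_G[t] by rewrite in_setI Gt cent1id.
have sZG := center_sub G.
pose E := ('Z(G) <*> <[t]>)%G.
have sZE : 'Z(G) \subset E := joing_subl _ _.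
have Et : t \in E by rewrite (subsetP (joing_subr _ _)) ?cycle_id.
have sZC : 'Z(G) \subset 'C_G[t].
  by apply/subsetP=> z Zz; rewrite in_setI (subsetP sZG) //; apply/cent1P/commute_sym/cZ.
have sEC : E \subset 'C_G[t] by rewrite join_subG sZC cycle_subG.
have leE : (#|E| <= p ^ 3)%N.
  rewrite /E /= cent_joinEl; last first.
    by rewrite centsC cycle_subG (subsetP _ t Gt) // centsC subsetIr.
  have := mul_cardG 'Z(G) <[t]>; rewrite oZ => e.
  apply: leq_trans (leq_pmulr _ (cardG_gt0 ('Z(G) :&: <[t]>))) _.
  by rewrite -e (expnSr p 2) leq_mul2l orbC dvdn_leq // order_dvdn expG.
have geE : (p ^ 3 <= #|E|)%N.
  rewrite expnSr -oZ; apply: (leq_p_proper pr_p _ sZE Et nZt).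
  exact: pgroupS (subset_trans sEC sCG) pG.
have /subsetPn[z Cz nEz] : ~~ ('C_G[t] \subset E).
  apply/negP=> /subset_leq_card/(leq_trans leC)/leq_trans/(_ leE).
  by rewrite leq_exp2l.
have [Gz /cent1P czt] := setIP Cz.
pose F := <<z |: E>>%G.
have sEF : E \subset F by rewrite (subset_trans (subsetUr [set z] E)) ?subset_gen.
have Fz : z \in F by rewrite mem_gen ?setU11.
have sFC : F \subset 'C_G[t] by rewrite gen_subG subUset sub1set Cz.
have geF : (p ^ 4 <= #|F|)%N.
  rewrite expnSr (leq_trans _ (leq_p_proper pr_p _ sEF Fz nEz)) //.
    by rewrite leq_mul2r geE orbT.
  exact: pgroupS (subset_trans sFC sCG) pG.
have /subsetPn[x Gx nCx] : ~~ (G \subset 'C_G[t]).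
  apply: contra nZt => sGC; apply/centerP; split=> // y Gy.
  by have /setIP[_ /cent1P/commute_sym] := subsetP sGC y Gy.
exists x, t, z; split=> //.
have sXG : [set x; t; z] \subset G by rewrite !subUset !sub1set Gx Gt.
apply: Phi_nongen; apply/eqP; rewrite eqEsubset join_subG Phi_sub sXG /=.
set B := _ <*> _; have sBG : B \subset G by rewrite join_subG Phi_sub.
have XB y : y \in [set x; t; z] -> y \in B by apply: (subsetP (joing_subr _ _)).
have Bx : x \in B by rewrite XB // !inE eqxx.
have Bt : t \in B by rewrite XB // !inE eqxx orbT.
have Bz : z \in B by rewrite XB // !inE eqxx orbT.
have sZB : 'Z(G) \subset B.
  by rewrite (subset_trans _ (joing_subl _ _)) // -defG' (Phi_joing pG) joing_subl.
have sFB : F \subset B.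
  by rewrite gen_subG subUset sub1set Bz join_subG sZB cycle_subG.
have nFx : x \notin F by apply: contra nCx; apply: (subsetP sFC).
have := leq_p_proper pr_p (pgroupS sBG pG) sFB Bx nFx => leB.
have /eqP -> : B == G; last exact: subxx.
rewrite eqEcard sBG oG expnSr; apply: leq_trans leB.
by rewrite leq_mul2r geF orbT.
Qed.

Lemma expgFD (g : gT) (a b : 'F_p) : g ^+ p = 1 -> g ^+ (a + b)%R = g ^+ a * g ^+ b.
Proof.
move=> gp; rewrite -expgD -{1}(natr_Zp a) -{1}(natr_Zp b) -GRing.natrD.
by rewrite val_Fp_nat // expg_mod.
Qed.

Lemma expgFM (g : gT) (a b : 'F_p) : g ^+ p = 1 -> g ^+ (a * b)%R = g ^+ (a * b)%N.
Proof.
move=> gp; rewrite -{1}(natr_Zp a) -{1}(natr_Zp b) -GRing.natrM.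
by rewrite val_Fp_nat // expg_mod.
Qed.

(** Collecting products into normal form makes the image of [phi] a subgroup; it contains the
    generators, so it is [G]. Injectivity then follows by counting p^5 tuples against |G|. *)
Lemma special_coordinates : exists phi : coords 'F_p -> gT,
  [/\ injective phi, forall g, g \in G -> exists v, g = phi v,
      forall v, phi v \in G & forall u v, phi u * phi v = phi (cmul u v)].
Proof.
have [x [t [z [Gx Gt Gz ctz genG]]]] := special_generators.
pose w2 := [~ x, t]; pose w3 := [~ x, z].
have Zw2 : w2 \in 'Z(G) by rewrite -defG' mem_commg.
have Zw3 : w3 \in 'Z(G) by rewrite -defG' mem_commg.
have Gw2 := subsetP (center_sub G) _ Zw2; have Gw3 := subsetP (center_sub G) _ Zw3.
have x_t i j : x ^+ i * t ^+ j = w2 ^+ (i * j)%N * (t ^+ j * x ^+ i).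
  rewrite commgC commXXg; try exact: cZ.
  by rewrite (cZ (groupX _ Zw2)) // groupM ?groupX.
have x_z i j : x ^+ i * z ^+ j = w3 ^+ (i * j)%N * (z ^+ j * x ^+ i).
  rewrite commgC commXXg; try exact: cZ.
  by rewrite (cZ (groupX _ Zw3)) // groupM ?groupX.
have z_t i j : z ^+ i * t ^+ j = t ^+ j * z ^+ i.
  exact/commuteX2/commute_sym.
clearbody w2 w3.
pose phi (v : coords 'F_p) : gT := let: (a, b, c, m, n) := v in
  w2 ^+ m * w3 ^+ n * (t ^+ b * (z ^+ c * x ^+ a)).
have phi_in v : phi v \in G.
  by case: v => [[[[a b] c] m] n]; rewrite /phi !groupM ?groupX.
have phiM u v : phi u * phi v = phi (cmul u v).
  move: u v => [[[[a b] c] m] n] [[[[a' b'] c'] m'] n'].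
  rewrite /phi /cmul !expgFD ?expgFM ?expG //.
  have pull2 i g y : g \in G -> g * (w2 ^+ i * y) = w2 ^+ i * (g * y).
    by move=> Gg; rewrite mulgA (cZ (groupX _ Zw2) Gg) -mulgA.
  have pull3 i g y : g \in G -> g * (w3 ^+ i * y) = w3 ^+ i * (g * y).
    by move=> Gg; rewrite mulgA (cZ (groupX _ Zw3) Gg) -mulgA.
  have xt i j y : x ^+ i * (t ^+ j * y) = w2 ^+ (i * j)%N * (t ^+ j * (x ^+ i * y)).
    by rewrite mulgA x_t -!mulgA.
  have xz i j y : x ^+ i * (z ^+ j * y) = w3 ^+ (i * j)%N * (z ^+ j * (x ^+ i * y)).
    by rewrite mulgA x_z -!mulgA.
  have zt i j y : z ^+ i * (t ^+ j * y) = t ^+ j * (z ^+ i * y).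
    by rewrite mulgA z_t -mulgA.
  have [[[Ga Gb] Gc] [Gn Gn']] : (x ^+ a \in G) * (t ^+ b \in G) * (z ^+ c \in G) *
     ((w3 ^+ n \in G) * (w3 ^+ n' \in G)) by rewrite !groupX.
  rewrite -!mulgA.
  rewrite (pull2 _ (x ^+ a)) // (pull2 _ (z ^+ c)) // (pull2 _ (t ^+ b)) //.
  rewrite (pull2 _ (w3 ^+ n)) // (pull3 _ (x ^+ a)) // (pull3 _ (z ^+ c)) //.
  rewrite (pull3 _ (t ^+ b)) // xt (pull2 _ (z ^+ c)) // (pull2 _ (t ^+ b)) //.
  rewrite (pull2 _ (w3 ^+ n')) // (pull2 _ (w3 ^+ n)) // zt xz.
  by rewrite (pull3 _ (z ^+ c)) // (pull3 _ (t ^+ b')) ?groupX // (pull3 _ (t ^+ b)).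
pose K := [set phi v | v in [set: coords 'F_p]].
have gK : group_set K.
  apply/group_setP; split=> [|_ _ /imsetP[u _ ->] /imsetP[v _ ->]].
    by apply/imsetP; exists (0, 0, 0, 0, 0)%R; rewrite ?inE //= /phi ?expg0 ?mulg1.
  by rewrite phiM imset_f ?inE.
have F1 g : g ^+ (1%R : 'F_p) = g by [].
have eK : K = G.
  apply/eqP; rewrite eqEsubset; apply/andP; split.
    by apply/subsetP=> _ /imsetP[v _ ->].
  rewrite -genG -[K]/(gval (Group gK)) gen_subG !subUset !sub1set; apply/andP; split.
    apply/andP; split; apply/imsetP.
      by exists (1, 0, 0, 0, 0)%R; rewrite ?inE //= /phi ?expg0 ?mul1g ?mulg1 ?F1.
    by exists (0, 1, 0, 0, 0)%R; rewrite ?inE //= /phi ?expg0 ?mul1g ?mulg1 ?F1.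
  by apply/imsetP; exists (0, 0, 1, 0, 0)%R; rewrite ?inE //= /phi ?expg0 ?mul1g ?mulg1 ?F1.
exists phi; split=> // [u v | g].
  apply: (imset_injP (D := [set: coords 'F_p]) _); rewrite ?inE //.
  rewrite -/K eK oG cardsT !card_prod card_Fp // !expnS expn0 muln1 !mulnA.
  by [].
by rewrite -eK => /imsetP[v _ ->]; exists v.
Qed.

End ExponentP.

Theorem theorem3p6 (gT : finGroupType) (G : {group gT}) (p : nat) :
  prime p -> odd p -> #|G| = (p ^ 5)%N -> #|('Z(G))%g| = (p ^ 2)%N ->
  ~ schur_multiplier_order G (p ^ 5).
Proof.
move=> pr_p odd_p oG oZ ordM.
suff [leM | geM] : multiplier_le G (p ^ 4) \/
    forall n, multiplier_le G n -> (p ^ 6 <= n)%N.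
- have := multiplier_le_order ordM leM.
  by rewrite leq_exp2l ?prime_gt1.
- have := geM _ (order_multiplier_le ordM).
  by rewrite leq_exp2l ?prime_gt1.
have [oG' | oG'] := p5_card_der pr_p oG oZ; last first.
  by left; apply: multiplier_p5_der_p3.
have [sG'Z | nsG'Z] := boolP (G^`(1) \subset 'Z(G))%g; last first.
  by left; apply: multiplier_p5_class3.
have defG' : (G^`(1) = 'Z(G))%g by apply/eqP; rewrite eqEcard sG'Z oG' oZ leqnn.
have [/existsP[x /andP[Gx ntx]] | expG] :=
  boolP [exists x, (x \in G) && (x ^+ p != 1)%g].
  by left; apply: multiplier_special Gx ntx.
right=> n leM.
have {}expG x : x \in G -> (x ^+ p = 1)%g.
  move=> Gx; apply/eqP; apply: contraNT expG => ntx.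
  by apply/existsP; exists x; rewrite Gx.
have [phi [phi_inj phi_onto phi_in phiM]] :=
  special_coordinates pr_p oG oZ defG' expG.
exact: (coords_multiplier_ge pr_p odd_p phi_inj phi_onto phi_in phiM leM).
Qed.
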